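(* Let $M^2$ be a surface isometrically immersed in $\mathbb{R}^4$, and let $E$ be the rank $1$ sub-bundle of $\wedge^2_-(\mathbb{R}^4)|_M$ spanned by $\omega^1=e^1\wedge e^2-\nu^1\wedge\nu^2$. The total space of $E$ over $M$ is an associative submanifold of $\wedge^2_-(\mathbb{R}^4)\cong\mathbb{R}^7$ if and only if the immersion $M\subset\mathbb{R}^4$ is minimal.
   Context: $\mathbb{R}^4$ carries its standard metric and orientation. Let $e_1,e_2$ be a local orthonormal tangent frame and $\nu_1,\nu_2$ a local orthonormal normal frame of $M$ such that $(e_1,e_2,\nu_1,\nu_2)$ is positively oriented in $\mathbb{R}^4$, with dual coframes $e^1,e^2,\nu^1,\nu^2$. Up to sign, the anti-self-dual $2$-form $\omega^1=e^1\wedge e^2-\nu^1\wedge\nu^2$ does not depend on the choice of frames, so $E=\operatorname{span}(\omega^1)$ is a well-defined line bundle over $M$. Its total space is regarded as an immersed $3$-dimensional submanifold of the total space of $\wedge^2_-(\mathbb{R}^4)$. $\mathrm{G}_2$-structure on $\wedge^2_-(\mathbb{R}^4)=\mathbb{R}^4\oplus\mathbb{R}^3\cong\mathbb{R}^7$: for an oriented orthonormal coframe $e^1,\dots,e^4$ of $\mathbb{R}^4$ put $\omega^1=e^1\wedge e^2-e^3\wedge e^4$, $\omega^2=e^1\wedge e^3-e^4\wedge e^2$, $\omega^3=e^1\wedge e^4-e^2\wedge e^3$. The vectors $\bar e_i=(e_i,0)$, $\check\omega^i=(0,\omega^i)$ are declared to be an orthonormal tangent frame of the total space, with dual coframe $\bar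 e^i,\check\omega_i$, and $$\varphi=\check\omega_1\wedge\check\omega_2\wedge\check\omega_3+\check\omega_1\wedge(\bar e^1\wedge\bar e^2-\bar e^3\wedge\bar e^4)+\check\omega_2\wedge(\bar e^1\wedge\bar e^3-\bar e^4\wedge\bar e^2)+\check\omega_3\wedge(\bar e^1\wedge\bar e^4-\bar e^2\wedge\bar e^3),$$ independently of the choice of oriented orthonormal coframe. Each tangent space of the total space is identified with the imaginary octonions $\operatorname{Im}\mathbb{O}$ by $\check\omega^1,\check\omega^2,\check\omega^3,\bar e_1,\bar e_2,\bar e_3,\bar e_4\mapsto \mathbf{i},\mathbf{j},\mathbf{k},\mathbf{e},\mathbf{ie},\mathbf{je},\mathbf{ke}$, where $\mathbb{O}=\mathbb{H}\oplus\mathbb{H}\mathbf{e}$ has product $(a+b\mathbf{e})(c+d\mathbf{e})=(ac-\bar d b)+(da+b\bar c)\mathbf{e}$ for $a,b,c,d\in\mathbb{H}$. A $3$-dimensional submanifold is associative if each of its tangent spaces is an associative subspace, i.e. the associator $[x,y,z]=(xy)z-x(yz)$ vanishes on it; equivalently $\varphi$ restricts to it as plus or minus the volume form. *)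

(* Defs.v *)
(* MathComp-Analysis. Tangent vectors are row vectors: ['d F x v = v *m 'J F x],
   so the rows of ['J F x] are the partial derivatives of F at x. *)
From HB Require Import structures.
From mathcomp Require Import all_boot all_order all_algebra.
From mathcomp Require Import all_classical all_reals all_analysis.
Import Order.TTheory GRing.Theory Num.Theory.
Import numFieldNormedType.Exports.

Set Implicit Arguments.
Unset Strict Implicit.
Unset Printing Implicit Defensive.

Local Open Scope classical_set_scope.
Local Open Scope ring_scope.

(* Meaningful for U open. *)
Fixpoint Ck_on (R : realType) (n : nat) (V : normedModType R) (k : nat)
    (U : set 'rV[R]_n) (F : 'rV[R]_n -> V) : Prop :=
  match k with
  | 0 => forall x, U x -> {for x, continuous F}
  | k'.+1 => (forall x, U x -> differentiable F x) /\
             forall v, Ck_on k' U (fun x => 'D_v F x)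
  end.

Definition smooth_on (R : realType) (n : nat) (V : normedModType R)
    (U : set 'rV[R]_n) (F : 'rV[R]_n -> V) : Prop :=
  forall k, Ck_on k U F.

Definition dot (R : realType) (n : nat) (u v : 'rV[R]_n) : R := (u *m v^T) 0 0.

(* [chart_map] and [chart_inv] are total functions, meaningful only on
   [chart_dom] and on [chart_im] respectively. *)
Record chart (R : realType) (n : nat) (M : topologicalType) := Chart {
  chart_dom : set M;
  chart_map : M -> 'rV[R]_n;
  chart_inv : 'rV[R]_n -> M }.

Definition chart_im (R : realType) (n : nat) (M : topologicalType)
    (c : chart R n M) : set 'rV[R]_n := chart_map c @` chart_dom c.

Definition is_chart (R : realType) (n : nat) (M : topologicalType)
    (c : chart R n M) : Prop :=
  [/\ open (chart_dom c), open (chart_im c),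
      {within chart_dom c, continuous (chart_map c)},
      {within chart_im c, continuous (chart_inv c)} &
      forall p, chart_dom c p -> chart_inv c (chart_map c p) = p].

Record smooth_manifold (R : realType) (n : nat) := SmoothManifold {
  carrier :> topologicalType;
  atlas : set (chart R n carrier);
  carrier_hausdorff : hausdorff_space carrier;
  carrier_second_countable : @second_countable carrier;
  atlas_chart : forall c, atlas c -> is_chart c;
  atlas_cover : forall p, exists2 c, atlas c & chart_dom c p;
  atlas_smooth : forall c c', atlas c -> atlas c' ->
    smooth_on (chart_map c @` (chart_dom c `&` chart_dom c'))
              (chart_map c' \o chart_inv c) }.

Arguments atlas {R n} s.

(* [gram c x] is the matrix of the metric in the coordinates of the chart c at
   the point with coordinates x; [gram_change] says that it is a tensor. *)
Record riemannian_metric (R : realType) (n : nat) (M : smooth_manifold R n) :=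
  RiemannianMetric {
  gram : chart R n M -> 'rV[R]_n -> 'M[R]_n;
  gram_smooth : forall c, atlas M c -> smooth_on (chart_im c) (gram c);
  gram_sym : forall c x, atlas M c -> chart_im c x -> (gram c x)^T = gram c x;
  gram_pos : forall c x v, atlas M c -> chart_im c x -> v != 0 ->
    0 < dot (v *m gram c x) v;
  gram_change : forall c c' p, atlas M c -> atlas M c' ->
    chart_dom c p -> chart_dom c' p ->
    let J := 'J (chart_map c' \o chart_inv c) (chart_map c p) in
    gram c (chart_map c p) = J *m gram c' (chart_map c' p) *m J^T }.

Definition isometric_immersion (R : realType) (n m : nat)
    (M : smooth_manifold R n) (g : riemannian_metric M)
    (f : M -> 'rV[R]_m) : Prop :=
  forall c, atlas M c ->
    smooth_on (chart_im c) (f \o chart_inv c) /\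
    forall x, chart_im c x ->
      let J := 'J (f \o chart_inv c) x in
      row_free J /\ J *m J^T = gram g c x.

Definition tangent_space (R : realType) (n m : nat) (M : smooth_manifold R n)
    (f : M -> 'rV[R]_m) (p : M) : set 'rV[R]_m :=
  [set v | exists c, [/\ atlas M c, chart_dom c p &
    (v <= 'J (f \o chart_inv c) (chart_map c p))%MS]].

Definition normal_part (R : realType) (n m : nat) (J : 'M[R]_(n, m))
    (v : 'rV[R]_m) : 'rV[R]_m :=
  v - v *m J^T *m invmx (J *m J^T) *m J.

Definition partial (R : realType) (n : nat) (V : normedModType R) (i : 'I_n)
    (F : 'rV[R]_n -> V) : 'rV[R]_n -> V :=
  fun x => 'D_(delta_mx 0 i) F x.

Definition second_fundamental_form (R : realType) (n m : nat)
    (F : 'rV[R]_n -> 'rV[R]_m) (x : 'rV[R]_n) (i j : 'I_n) : 'rV[R]_m :=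
  normal_part ('J F x) (partial i (partial j F) x).

(* The trace, not divided by n. *)
Definition mean_curvature (R : realType) (n m : nat) (M : smooth_manifold R n)
    (g : riemannian_metric M) (f : M -> 'rV[R]_m) (c : chart R n M)
    (x : 'rV[R]_n) : 'rV[R]_m :=
  \sum_i \sum_j invmx (gram g c x) i j *:
    second_fundamental_form (f \o chart_inv c) x i j.

Definition minimal (R : realType) (n m : nat) (M : smooth_manifold R n)
    (g : riemannian_metric M) (f : M -> 'rV[R]_m) : Prop :=
  forall c x, atlas M c -> chart_im c x -> mean_curvature g f c x = 0.

(* A 2-form on R^4 is encoded by the skew-symmetric matrix of its values on
   pairs of standard basis vectors; vectors and covectors are identified by the
   standard metric. *)
Definition wedge (R : realType) (a b : 'rV[R]_4) : 'M[R]_4 :=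
  a^T *m b - b^T *m a.

(* The forms omega^1, omega^2, omega^3 of the coframe given by the rows of A. *)
Definition omega (R : realType) (A : 'M[R]_4) (i : 'I_3) : 'M[R]_4 :=
  let e (k : 'I_4) := row k A in
  [:: wedge (e 0) (e 1) - wedge (e 2) (e 3);
      wedge (e 0) (e 2) - wedge (e 3) (e 1);
      wedge (e 0) (e 3) - wedge (e 1) (e 2)]`_i.

Definition omega_std (R : realType) (i : 'I_3) : 'M[R]_4 := omega 1%:M i.

(* The total space of the bundle of anti-self-dual 2-forms, inside
   R^4 x (4 x 4 matrices). *)
Definition asd_bundle (R : realType) : set ('rV[R]_4 * 'M[R]_4) :=
  [set q | exists a : 'I_3 -> R, q.2 = \sum_i a i *: omega_std R i].

Arguments asd_bundle R : clear implicits.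

(* The dual coframe of [omega_std] on anti-self-dual forms: the [omega_std] are
   pairwise orthogonal for the trace pairing. *)
Definition omega_dual (R : realType) (i : 'I_3) (eta : 'M[R]_4) : R :=
  \tr (eta *m (omega_std R i)^T) / \tr (omega_std R i *m (omega_std R i)^T).

(* [quat a b c d] is a + b i + c j + d k. *)
Definition quat (R : realType) (a b c d : R) : 'rV[R]_4 :=
  \row_(i < 4) [:: a; b; c; d]`_i.

Definition qmul (R : realType) (x y : 'rV[R]_4) : 'rV[R]_4 :=
  let x0 := x 0 0 in let x1 := x 0 1 in let x2 := x 0 2 in let x3 := x 0 3 in
  let y0 := y 0 0 in let y1 := y 0 1 in let y2 := y 0 2 in let y3 := y 0 3 in
  quat (x0 * y0 - x1 * y1 - x2 * y2 - x3 * y3)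
       (x0 * y1 + x1 * y0 + x2 * y3 - x3 * y2)
       (x0 * y2 - x1 * y3 + x2 * y0 + x3 * y1)
       (x0 * y3 + x1 * y2 - x2 * y1 + x3 * y0).

Definition qconj (R : realType) (x : 'rV[R]_4) : 'rV[R]_4 :=
  quat (x 0 0) (- x 0 1) (- x 0 2) (- x 0 3).

(* The pair (a, b) of quaternions is the octonion a + b e. *)
Definition octonion (R : realType) : Type := ('rV[R]_4 * 'rV[R]_4)%type.

Definition omul (R : realType) (x y : octonion R) : octonion R :=
  let: (a, b) := x in let: (c, d) := y in
  (qmul a c - qmul (qconj d) b, qmul d a + qmul b (qconj c)).

Definition associator (R : realType) (x y z : octonion R) : octonion R :=
  let: (a, b) := omul (omul x y) z in
  let: (c, d) := omul x (omul y z) in (a - c, b - d).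

(* The frame omega^1, omega^2, omega^3, e_1, e_2, e_3, e_4 of the standard basis
   of R^4 goes to i, j, k, e, ie, je, ke. *)
Definition to_octonion (R : realType) (q : 'rV[R]_4 * 'M[R]_4) : octonion R :=
  (quat 0 (omega_dual 0 q.2) (omega_dual 1 q.2) (omega_dual 2 q.2), q.1).

Definition associative_subspace (R : realType)
    (T : set ('rV[R]_4 * 'M[R]_4)) : Prop :=
  forall x y z, T x -> T y -> T z ->
    associator (to_octonion x) (to_octonion y) (to_octonion z) = 0.

(* A smooth k-dimensional space mapped to V: the points of the space are the
   elements of [imm_pts], the map is [imm_map], and [imm_par] is a set of local
   parametrizations of the space, each given with its domain. *)
Record immersed_data (R : realType) (k : nat) (V : normedModType R) :=
  ImmersedData {
  imm_type : Type;
  imm_pts : set imm_type;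
  imm_map : imm_type -> V;
  imm_par : set (set 'rV[R]_k * ('rV[R]_k -> imm_type)) }.

Arguments imm_pts {R k V} _.
Arguments imm_map {R k V} _ _.
Arguments imm_par {R k V} _.

(* N is the ambient subset of V. The last clause says that the changes of
   parametrization [tau] are smooth. *)
Definition is_immersed_submanifold (R : realType) (k : nat)
    (V : normedModType R) (S : immersed_data k V) (N : set V) : Prop :=
  [/\ forall q, imm_pts S q <->
        exists2 P, imm_par S P & exists2 y, P.1 y & P.2 y = q,
      forall q, imm_pts S q -> N (imm_map S q),
      forall P, imm_par S P ->
        [/\ open P.1,
            {in P.1 &, injective P.2},
            smooth_on P.1 (imm_map S \o P.2) &
            forall y, P.1 y -> injective ('d (imm_map S \o P.2) y)] &
      forall P P' y y', imm_par S P -> imm_par S P' ->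
        P.1 y -> P'.1 y' -> P.2 y = P'.2 y' ->
        exists U tau, [/\ open U, U y, U `<=` P.1, smooth_on U tau &
          forall z, U z -> P'.1 (tau z) /\ P'.2 (tau z) = P.2 z]].

(* The tangent space at the point P.2 y. *)
Definition imm_tangent (R : realType) (k : nat) (V : normedModType R)
    (S : immersed_data k V) (P : set 'rV[R]_k * ('rV[R]_k -> imm_type S))
    (y : 'rV[R]_k) : set V :=
  range ('d (imm_map S \o P.2) y).

Definition associative_submanifold (R : realType)
    (S : immersed_data 3 ('rV[R]_4 * 'M[R]_4)%type) : Prop :=
  is_immersed_submanifold S (asd_bundle R) /\
  forall P y, imm_par S P -> P.1 y -> associative_subspace (imm_tangent P y).

(* The rows of A are e_1, e_2, nu_1, nu_2. *)
Definition adapted_frame (R : realType) (M : smooth_manifold R 2)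
    (f : M -> 'rV[R]_4) (p : M) (A : 'M[R]_4) : Prop :=
  [/\ A *m A^T = 1%:M, \det A = 1,
      tangent_space f p (row 0 A), tangent_space f p (row 1 A) &
      forall v, tangent_space f p v -> dot (row 2 A) v = 0 /\ dot (row 3 A) v = 0].

Definition local_adapted_frame (R : realType) (M : smooth_manifold R 2)
    (f : M -> 'rV[R]_4) (c : chart R 2 M) (W : set 'rV[R]_2)
    (A : 'rV[R]_2 -> 'M[R]_4) : Prop :=
  [/\ atlas M c, open W, W `<=` chart_im c, smooth_on W A &
      forall x, W x -> adapted_frame f (chart_inv c x) (A x)].

(* The total space of E = span(omega^1), with points (p, eta) for p in M and
   eta in E_p. A local adapted frame gives the local section omega^1 of E and
   the parametrization (x, t) |-> t omega^1(x). The sign ambiguity of omega^1 is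
   harmless since all adapted frames are used. *)
Definition total_space_E (R : realType) (M : smooth_manifold R 2)
    (f : M -> 'rV[R]_4) : immersed_data 3 ('rV[R]_4 * 'M[R]_4)%type :=
  {| imm_type := (M * 'M[R]_4)%type;
     imm_pts := [set q | exists2 A, adapted_frame f q.1 A &
                         exists t : R, q.2 = t *: omega A 0];
     imm_map := fun q => (f q.1, q.2);
     imm_par := [set P | exists c W A, local_adapted_frame f c W A /\
       P = ([set y : 'rV[R]_(2 + 1) | W (lsubmx y)],
            fun y : 'rV[R]_(2 + 1) =>
              (chart_inv c (lsubmx y),
               rsubmx y 0 0 *: omega (A (lsubmx y)) 0))] |}.

(* Main.v *)
(* Anti-self-dual 2-forms on R^4 are the right multiplications by imaginary
   quaternions, and for e in SO(4) the forms omega^i become right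
   multiplications by n1 = conj(e_1) e_2, n2 = conj(e_1) e_3 and n1 n2.
   Differentiating the frame gives d omega^1 = alpha omega^2 + beta omega^3, so
   the tangent space of E at t omega^1 is spanned by (omega^1, 0) and
   (t (alpha(e_k) omega^2 + beta(e_k) omega^3), e_k), k = 1, 2.  The octonion
   product of the first of these vectors with the one for k = 1 is
   (t (alpha(e_1) omega^3 - beta(e_1) omega^2), e_2), so the tangent space is
   associative iff t alpha(e_2) = - t beta(e_1) and t beta(e_2) = t alpha(e_1).
   By the symmetry of the second fundamental form, alpha(e_2) + beta(e_1) and
   beta(e_2) - alpha(e_1) are the components of the mean curvature vector along
   nu_1 and nu_2. *)
Require Import Defs.
From HB Require Import structures.
From mathcomp Require Import all_boot all_order all_algebra.
From mathcomp Require Import all_classical all_reals all_analysis.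
From mathcomp Require Import ring lra.
Import Order.TTheory GRing.Theory Num.Theory.
Import numFieldNormedType.Exports.

Set Implicit Arguments.
Unset Strict Implicit.
Unset Printing Implicit Defensive.

Local Open Scope classical_set_scope.
Local Open Scope ring_scope.

(** At t = 0 the tangent space of E is associative for every immersion, so the zero section says
    nothing about curvature; the converse is read off on the section t = 1, while minimality gives
    the condition for all t. The curvature identities need no special coordinates. The coordinate
    vectors b0 and b1 of e_1 and e_2 are frozen at one point x: the field ['D_b F] with constant b
    is tangent everywhere and agrees with a frame vector at x, so second derivatives of the
    immersion replace derivatives of the coordinates of the frame. That E is an immersed submanifold
    holds without minimality and takes separate work. It requires a smooth adapted frame near every
    point, and a smooth change of fibre coordinate between two frames, whose forms omega^1 agree
    only up to sign. *)

Lemma open_near_eq (T : topologicalType) (S : Type) (U : set T) (F G : T -> S) x :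
  open U -> U x -> (forall y, U y -> F y = G y) -> \near x, F x = G x.
Proof.
by move=> oU Ux FG; apply: filterS (open_nbhs_nbhs (conj oU Ux)).
Qed.

(** A little-o expansion depends only on the germ at [x], so the expansion of [F] with linear part
    ['d F x] is also one of [G]; [diff_unique] then identifies this linear part with ['d G x]. *)
Lemma near_eq_differentiable (R : numFieldType) (V W : normedModType R)
    (F G : V -> W) (x : V) :
  (\near x, F x = G x) -> differentiable F x -> differentiable G x.
Proof.
move=> FG dF.
have H : G \o shift x = cst (G x) + 'd F x +o_ (0 : V) id.
  apply/eqaddoP => e e0.
  have /eqaddoP/(_ e e0) := diff_locally dF.
  have := FG; rewrite (near_shift 0) /= subr0 => FG'.
  have <- : F x = G x by exact: nbhs_singleton FG.
  move=> H; near=> h.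
  have -> : (G \o +%R^~ x - (cst (F x) + 'd F x)) h =
      (F \o +%R^~ x - (cst (F x) + 'd F x)) h.
    by rewrite !fctE /=; congr (_ - _); symmetry; near: h.
  by near: h.
have E := diff_unique (diff_continuous dF) H.
apply/diff_locallyP; split; first by rewrite E; exact: diff_continuous.
by rewrite E.
Unshelve. all: by end_near. Qed.

(** * Calculus of C^k maps on open sets *)

Section Smooth.
Variable (R : realType) (n : nat).
Implicit Types (U : set 'rV[R]_n) (k : nat).

(** [Ck_on] iterates ['D_v F], a function on the whole space, whereas the derivative formulas used
    below hold only on [U]. Openness of [U] makes this enough: agreement on [U] fixes the germs,
    hence the derivatives. *)
Lemma Ck_on_eq (V : normedModType R) k U (F G : 'rV[R]_n -> V) :
  open U -> (forall x, U x -> F x = G x) -> Ck_on k U F -> Ck_on k U G.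
Proof.
move=> oU; elim: k F G => [|k IH] F G FG /=.
  move=> cF x Ux; have FGx := open_near_eq oU Ux FG.
  have := cF x Ux; rewrite /prop_for/= /continuous_at (FG _ Ux).
  by apply: cvg_trans; exact: (near_eq_cvg FGx).
move=> [dF CF]; split.
  by move=> x Ux; apply: near_eq_differentiable (dF x Ux); exact: open_near_eq FG.
move=> v; apply: IH (CF v) => x Ux.
by apply: near_eq_derive; exact: open_near_eq FG.
Qed.

Lemma Ck_on_sub (V : normedModType R) k U U' (F : 'rV[R]_n -> V) :
  U' `<=` U -> Ck_on k U F -> Ck_on k U' F.
Proof.
move=> UU'; elim: k F => [|k IH] F /=; first by move=> cF x /UU'/cF.
by move=> [dF CF]; split=> [x /UU'/dF //|v]; exact: IH.
Qed.

Lemma Ck_onW (V : normedModType R) k U (F : 'rV[R]_n -> V) :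
  Ck_on k.+1 U F -> Ck_on k U F.
Proof.
elim: k F => [|k IH] F [dF CF].
  by move=> x Ux; apply: differentiable_continuous; exact: dF.
by split => // v; apply: IH.
Qed.

Lemma smooth_on_sub (V : normedModType R) U U' (F : 'rV[R]_n -> V) :
  U' `<=` U -> smooth_on U F -> smooth_on U' F.
Proof. by move=> UU' sF k; exact: Ck_on_sub (sF k). Qed.

Lemma smooth_on_differentiable (V : normedModType R) U (F : 'rV[R]_n -> V) x :
  smooth_on U F -> U x -> differentiable F x.
Proof. by move=> sF Ux; case: (sF 1) => dF _; exact: dF. Qed.

Lemma smooth_on_derive (V : normedModType R) U (F : 'rV[R]_n -> V) v :
  smooth_on U F -> smooth_on U (fun x => 'D_v F x).
Proof. by move=> sF k; have [_] := sF k.+1; apply. Qed.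

Lemma Ck_on_cst (V : normedModType R) k U (a : V) : Ck_on k U (fun _ => a).
Proof.
elim: k a => [|k IH] a; first by move=> x _; exact: cst_continuous.
split=> [x _|v]; first exact: differentiable_cst.
have -> : 'D_v (fun _ : 'rV[R]_n => a) = fun _ => 0.
  by apply/funext => x; exact: derive_cst.
exact: IH.
Qed.

Lemma Ck_on_linear (V : normedModType R) k U (L : {linear 'rV[R]_n -> V}) :
  continuous L -> Ck_on k U L.
Proof.
move=> cL; case: k => [|k]; first by move=> x _; exact: cL.
split=> [x _|v]; first exact: linear_differentiable.
have -> : 'D_v L = fun _ => L v.
  apply/funext => x; rewrite deriveE ?diff_lin//; exact: linear_differentiable.
exact: Ck_on_cst.
Qed.

Lemma Ck_onD (V : normedModType R) k U (F G : 'rV[R]_n -> V) : open U ->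
  Ck_on k U F -> Ck_on k U G -> Ck_on k U (fun x => F x + G x).
Proof.
move=> oU; elim: k F G => [|k IH] F G /=.
  by move=> cF cG x Ux; exact: continuousD (cF x Ux) (cG x Ux).
move=> [dF CF] [dG CG]; split=> [x Ux|v].
  by apply: differentiableD; [exact: dF|exact: dG].
apply: Ck_on_eq (IH _ _ (CF v) (CG v)) => // x Ux.
by rewrite [RHS]deriveD//; apply: diff_derivable; [exact: dF|exact: dG].
Qed.

Lemma Ck_on_sum (V : normedModType R) k U m (F : 'I_m -> 'rV[R]_n -> V) :
  open U -> (forall i, Ck_on k U (F i)) -> Ck_on k U (fun x => \sum_i F i x).
Proof.
move=> oU; elim: m F => [|m IH] F CF.
  by under eq_fun do rewrite big_ord0; exact: Ck_on_cst.
under eq_fun do rewrite big_ord_recl.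
by apply: Ck_onD => //; exact: IH.
Qed.

Lemma Ck_onZl (V : normedModType R) k U (f : 'rV[R]_n -> R) (a : V) : open U ->
  Ck_on k U f -> Ck_on k U (fun x => f x *: a).
Proof.
move=> oU; elim: k f => [|k IH] f /=.
  by move=> cf x Ux; exact: cvgZr_tmp (cf x Ux).
move=> [df Cf]; split=> [x Ux|v]; first by apply: differentiableZl; exact: df.
apply: Ck_on_eq (IH _ (Cf v)) => // x Ux.
rewrite [RHS]deriveE; last by apply: differentiableZl; exact: df.
by rewrite diffZl ?deriveE//; exact: df.
Qed.

Lemma Ck_onM k U (f g : 'rV[R]_n -> R) : open U ->
  Ck_on k U f -> Ck_on k U g -> Ck_on k U (fun x => f x * g x).
Proof.
move=> oU; elim: k f g => [|k IH] f g.
  by move=> cf cg x Ux; exact: continuousM (cf x Ux) (cg x Ux).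
move=> Cf Cg; have [cf cg] := (Ck_onW Cf, Ck_onW Cg).
case: Cf Cg => df Cf [dg Cg]; split=> [x Ux|v].
  by apply: differentiableM; [exact: df|exact: dg].
apply: Ck_on_eq (Ck_onD oU (IH _ _ cf (Cg v)) (IH _ _ cg (Cf v))) => // x Ux.
by rewrite [RHS]deriveM//; apply: diff_derivable; [exact: df|exact: dg].
Qed.

Lemma Ck_on_mxP k U p q (F : 'rV[R]_n -> 'M[R]_(p, q)) : open U ->
  Ck_on k U F <-> forall i j, Ck_on k U (fun x => F x i j).
Proof.
move=> oU; split; last first.
  move=> CF; apply: (@Ck_on_eq _ _ _
    (fun x => \sum_i \sum_j F x i j *: delta_mx i j)) => //.
    by move=> x _; rewrite -matrix_sum_delta.
  by apply: Ck_on_sum => // i; apply: Ck_on_sum => // j; exact: Ck_onZl.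
elim: k F => [|k IH] F /=.
  move=> cF i j x Ux.
  apply: (@continuous_comp _ _ _ F (fun N : 'M[R]_(p, q) => N i j)); first exact: cF.
  exact: coord_continuous.
move=> [dF CF] i j; split=> [x Ux|v].
  apply: (@differentiable_comp _ _ _ _ F (fun N : 'M[R]_(p, q) => N i j)); first exact: dF.
  exact: differentiable_coord.
apply: Ck_on_eq (IH _ (CF v) i j) => // x Ux.
by rewrite derive_mx ?mxE//; apply: diff_derivable; exact: dF.
Qed.

Lemma Ck_on_pair (V W : normedModType R) k U
    (F : 'rV[R]_n -> V) (G : 'rV[R]_n -> W) : open U ->
  Ck_on k U F -> Ck_on k U G -> Ck_on k U (fun x => (F x, G x)).
Proof.
move=> oU; elim: k F G => [|k IH] F G /=.
  by move=> cF cG x Ux; exact: cvg_pair (cF x Ux) (cG x Ux).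
move=> [dF CF] [dG CG]; split=> [x Ux|v].
  by apply: differentiable_pair; [exact: dF|exact: dG].
apply: Ck_on_eq (IH _ _ (CF v) (CG v)) => // x Ux.
have [dFx dGx] := (dF _ Ux, dG _ Ux).
rewrite [RHS]deriveE; last exact: differentiable_pair.
by rewrite diff_pair// !deriveE.
Qed.

Lemma derive_sum_delta m (V : normedModType R) (G : 'rV[R]_m -> V) x w :
  differentiable G x -> 'D_w G x = \sum_i w 0 i *: 'D_(delta_mx 0 i) G x.
Proof.
move=> dG; rewrite deriveE// {1}(row_sum_delta w) linear_sum.
by apply: eq_bigr => i _; rewrite linearZ deriveE.
Qed.

(** The chain rule is written in coordinates, as a sum of products of an entry of ['D_v phi] with a
    partial derivative of [G] composed with [phi]. Each such composite has the same shape as the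
    original one, with one degree of smoothness less, so the induction closes. *)
Lemma Ck_on_comp m k U (U' : set 'rV[R]_m) (phi : 'rV[R]_n -> 'rV[R]_m)
    (G : 'rV[R]_m -> R) :
  open U -> (forall x, U x -> U' (phi x)) ->
  Ck_on k U phi -> Ck_on k U' G -> Ck_on k U (fun x => G (phi x)).
Proof.
move=> oU UU'; elim: k G => [|k IH] G.
  move=> cphi cG x Ux; apply: continuous_comp; first exact: cphi.
  exact/cG/UU'.
move=> Cphi CG; have cphi := Ck_onW Cphi.
case: Cphi CG => dphi Cphi [dG CG]; split=> [x Ux|v].
  by apply: (@differentiable_comp _ _ _ _ phi); [exact: dphi|exact/dG/UU'].
apply: (@Ck_on_eq _ _ _ (fun x => \sum_i
   ('D_v phi x) 0 i * ('D_(delta_mx 0 i) G (phi x)))) => //; last first.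
  apply: Ck_on_sum => // i; apply: Ck_onM => //; last exact: IH cphi (CG _).
  by have /(Ck_on_mxP _ _ oU) := Cphi v; apply.
move=> x Ux; have dGx := dG _ (UU' _ Ux); have dphix := dphi _ Ux.
rewrite [RHS]deriveE; last exact: (@differentiable_comp _ _ _ _ phi).
rewrite diff_comp//= -[RHS]deriveE// [RHS]derive_sum_delta//.
by rewrite deriveE.
Qed.

(* Bootstrap: h = q^(-1/2) satisfies h' = - h^3 q' / 2, so h is C^(k+1) as soon as
   it is C^k and q is C^(k+1). *)
Lemma Ck_on_invsqrt k U (q : 'rV[R]_n -> R) :
  open U -> (forall x, U x -> 0 < q x) ->
  Ck_on k U q -> Ck_on k U (fun x => (Num.sqrt (q x))^-1).
Proof.
move=> oU q0; elim: k => [|k IH].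
  move=> cq x Ux; have s0 : Num.sqrt (q x) != 0 by rewrite gt_eqF// sqrtr_gt0 q0.
  apply: (@continuousV _ _ (fun x => Num.sqrt (q x))) => //.
  by apply: (@continuous_comp _ _ _ q); [exact: cq|exact: sqrt_continuous].
move=> Cq; have cq := Ck_onW Cq; case: Cq => dq Cq.
have ds x : U x -> differentiable (fun x => Num.sqrt (q x)) x.
  move=> Ux; apply: (@differentiable_comp _ _ _ _ q); first exact: dq.
  apply/derivable1_diffP; apply: ex_derive; exact: is_derive1_sqrt (q0 _ Ux).
split=> [x Ux|v].
  by apply: differentiableV; [exact: ds|rewrite gt_eqF// sqrtr_gt0 q0].
have H := IH cq.
apply: (@Ck_on_eq _ _ _ (fun x => - 2^-1 * ((Num.sqrt (q x))^-1 *
   ((Num.sqrt (q x))^-1 * (Num.sqrt (q x))^-1)) * 'D_v q x)) => //; last first.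
  apply: Ck_onM (Cq v) => //.
  by apply: Ck_onM (Ck_onM oU H (Ck_onM oU H H)) => //; exact: Ck_on_cst.
move=> x Ux; have s0 : Num.sqrt (q x) != 0 by rewrite gt_eqF// sqrtr_gt0 q0.
rewrite [RHS]deriveV//; last exact/diff_derivable/ds.
rewrite deriveE; last exact: dq.
rewrite deriveE; last exact: ds.
have dsq : differentiable (@Num.sqrt R) (q x).
  apply/derivable1_diffP; apply: ex_derive; exact: is_derive1_sqrt (q0 _ Ux).
rewrite (@diff_comp _ _ _ _ q Num.sqrt)//=; last exact: dq.
have -> : 'd (@Num.sqrt R) (q x) ('d q x v) = 'd q x v * (2 * Num.sqrt (q x))^-1.
  rewrite -derive_sqrt ?q0// deriveE//.
  by rewrite -[in LHS](mulr1 ('d q x v)); exact: linearZ.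
rewrite /GRing.scale/=.
by field.
Qed.

End Smooth.

(** * Symmetry of second derivatives *)

Section Schwarz.
Variable (R : realType) (n : nat).
Implicit Types (U : set 'rV[R]_n).

Lemma is_derive_line (V W : normedModType R) (G : V -> W) (v y : V) (s : R) :
  differentiable G (s *: v + y) ->
  is_derive s 1 (fun s => G (s *: v + y)) ('D_v G (s *: v + y)).
Proof.
move=> dG.
have dZ : differentiable (fun s : R => s *: v) s.
  exact: (@differentiableZl _ _ _ (fun s : R => s)).
have dl : differentiable (fun s : R => s *: v + y) s by exact: differentiableD.
have dGl := @differentiable_comp _ _ _ _ (fun s : R => s *: v + y) G s dl dG.
apply: DeriveDef; first exact: diff_derivable.
rewrite deriveE// (diff_comp dl dG) /= [RHS]deriveE//; congr ('d G _ _).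
rewrite (_ : 'd _ s = ( *:%R^~ v : R -> V) :> (R -> V)) ?scale1r//.
rewrite (@diffD _ _ _ (fun s : R => s *: v) (cst y))// diff_cst.
apply/funext => t /=; rewrite [LHS]addr0 (@diffZl _ _ _ (fun s : R => s))//.
by rewrite diff_val.
Qed.

(** Two mean value theorems: one for the difference of [G] along the two sides of the parallelogram
    parallel to [v], which gives [s]; then one for ['D_v G] along [w] at this [s], which gives
    [t]. *)
Lemma second_difference U (G : 'rV[R]_n -> R) (x v w : 'rV[R]_n) (h : R) :
  smooth_on U G -> 0 < h ->
  (forall s t : R, 0 <= s <= h -> 0 <= t <= h -> U (s *: v + (t *: w + x))) ->
  exists s t : R, [/\ 0 <= s <= h, 0 <= t <= h &
    G (h *: v + (h *: w + x)) - G (h *: v + x) - G (h *: w + x) + G x =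
    h ^+ 2 * 'D_w (fun z => 'D_v G z) (s *: v + (t *: w + x))].
Proof.
move=> sG h0 hU.
have h00 : (0 : R) <= 0 <= h by rewrite lexx ltW.
have hh : 0 <= h <= h by rewrite lexx ltW.
have U0 (s : R) : 0 <= s <= h -> U (s *: v + x).
  by move=> hs; have := hU s 0 hs h00; rewrite scale0r add0r.
have itv (s : R) : s \in `[0, h]%R -> 0 <= s <= h by rewrite in_itv.
have itvo (s : R) : s \in `]0, h[%R -> 0 <= s <= h.
  by rewrite in_itv/= => /andP[/ltW-> /ltW->].
have dG y : U y -> differentiable G y by exact: smooth_on_differentiable.
have dline (s : R) : 0 <= s <= h -> is_derive s 1
    ((fun s => G (s *: v + (h *: w + x))) - (fun s => G (s *: v + x)))
    ('D_v G (s *: v + (h *: w + x)) - 'D_v G (s *: v + x)).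
  move=> hs; apply: is_deriveB; apply: is_derive_line; apply: dG; last exact: U0.
  exact: hU.
have [|s /itvo hs] := MVT h0 (fun s hs => dline s (itvo s hs)).
  apply: derivable_within_continuous => s /itv hs.
  by have [] := dline s hs.
rewrite !fctE scale0r !add0r subr0 => Es.
have sG' := smooth_on_derive v sG.
have dline' (t : R) : 0 <= t <= h -> is_derive t 1
    (fun t => 'D_v G (t *: w + (s *: v + x)))
    ('D_w (fun z => 'D_v G z) (t *: w + (s *: v + x))).
  move=> ht; apply: is_derive_line; apply: smooth_on_differentiable sG' _.
  by rewrite addrCA; exact: hU.
have [|t /itvo ht] := MVT h0 (fun t ht => dline' t (itvo t ht)).
  apply: derivable_within_continuous => t /itv ht.
  by have [] := dline' t ht.
rewrite scale0r add0r subr0 addrCA => Et.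
exists s, t; split => //.
move: Es; rewrite Et [t *: w + _]addrCA; set D := 'D_w _ _ => Es.
transitivity (D * h * h); last by ring.
by rewrite -Es; ring.
Qed.

(* Evaluating the same second difference with v and w exchanged gives both mixed
   derivatives at points arbitrarily close to x. *)
Lemma derive_sym U (G : 'rV[R]_n -> R) (x v w : 'rV[R]_n) :
  open U -> U x -> smooth_on U G ->
  'D_v (fun z => 'D_w G z) x = 'D_w (fun z => 'D_v G z) x.
Proof.
move=> oU Ux sG.
have cD a b : {for x, continuous (fun z => 'D_a (fun z => 'D_b G z) z)}.
  exact: (smooth_on_derive a (smooth_on_derive b sG)) 0%N x Ux.
apply/eqP; rewrite -subr_eq0 -normr_le0; apply/ler_addgt0Pl => e e0; rewrite addr0.
have e2 : 0 < e / 2 by rewrite divr_gt0.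
have tri (a b m : R) : `|a - m| < e / 2 -> `|b - m| < e / 2 -> `|a - b| <= e.
  move=> am bm; rewrite (_ : a - b = (a - m) - (b - m)); last by ring.
  by rewrite (le_trans (ler_normB _ _))// (splitr e) lerD// ltW.
have near_line (P : set 'rV[R]_n) : nbhs x P -> exists2 h, 0 < h &
    forall s t : R, 0 <= s <= h -> 0 <= t <= h -> P (s *: v + (t *: w + x)).
  move=> /nbhs_ballP[r /= r0 rP].
  (* The summand 1 keeps [c] positive when [v] and [w] both vanish; parameters of size at most
     [r / 2 / c] then move [x] by less than [r]. *)
  pose c := `|v| + `|w| + 1.
  have c0 : 0 < c by rewrite ltr_wpDl// addr_ge0.
  exists (r / 2 / c); first by rewrite !divr_gt0.
  move=> s t /andP[s0 sh] /andP[t0 th]; apply: rP.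
  rewrite -ball_normE /= distrC addrA addrK.
  rewrite (le_lt_trans (ler_normD _ _))// !normrZ !ger0_norm//.
  apply: (@le_lt_trans _ _ (r / 2 / c * (`|v| + `|w|))).
    by rewrite mulrDr lerD// ler_wpM2r.
  apply: (@lt_trans _ _ (r / 2 / c * c)).
    by rewrite ltr_pM2l ?divr_gt0// /c ltrDl.
  by rewrite divfK ?gt_eqF// ltr_pdivrMr// ltr_pMr// ltr1n.
have [h h0 hP] := near_line _ (filterI (open_nbhs_nbhs (conj oU Ux))
  (filterI ((@cvgrPdist_lt _ _ _ _ _ _ _).1 (cD v w) _ e2)
           ((@cvgrPdist_lt _ _ _ _ _ _ _).1 (cD w v) _ e2))).
have [s [t [hs ht]]] := second_difference sG h0 (fun s t hs ht => (hP s t hs ht).1).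
have hU' (s' t' : R) : 0 <= s' <= h -> 0 <= t' <= h -> U (s' *: w + (t' *: v + x)).
  by move=> hs' ht'; rewrite addrCA; exact: (hP t' s' ht' hs').1.
have [t' [s' [ht' hs']]] := second_difference sG h0 hU'.
rewrite [h *: w + (h *: v + x)]addrCA [t' *: w + _]addrCA => E' E.
(* The second difference is symmetric in [v] and [w], up to the order of its two middle terms. *)
have : h ^+ 2 * 'D_w (fun z => 'D_v G z) (s *: v + (t *: w + x)) =
       h ^+ 2 * 'D_v (fun z => 'D_w G z) (s' *: v + (t' *: w + x)).
  have AC (a b c d : R) : a - b - c + d = a - c - b + d by rewrite [a - b - c]addrAC.
  exact: etrans (esym E) (etrans (AC _ _ _ _) E').
move/(mulfI (lt0r_neq0 (exprn_gt0 2 h0))) => EE.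
have [_ [_ H1]] := hP s t hs ht; have [_ [H2 _]] := hP s' t' hs' ht'.
rewrite EE in H1; exact: tri H2 H1.
Qed.

End Schwarz.

Section Index.

Lemma ord4_ind (P : 'I_4 -> Prop) : P 0 -> P 1 -> P 2 -> P 3 -> forall i, P i.
Proof.
move=> P0 P1 P2 P3 [[|[|[|[|//]]]] i4];
  [have -> : Ordinal i4 = 0 | have -> : Ordinal i4 = 1 |
   have -> : Ordinal i4 = 2 | have -> : Ordinal i4 = 3]; by [|apply/val_inj].
Qed.

Lemma big_ord4 (V : nmodType) (F : 'I_4 -> V) :
  \sum_i F i = F 0 + F 1 + F 2 + F 3.
Proof.
rewrite !big_ord_recl big_ord0 addr0 !addrA.
by congr (F _ + F _ + F _ + F _); apply/val_inj.
Qed.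

Lemma ord3_ind (P : 'I_3 -> Prop) : P 0 -> P 1 -> P 2 -> forall i, P i.
Proof.
move=> P0 P1 P2 [[|[|[|//]]] i4];
  [have -> : Ordinal i4 = 0 | have -> : Ordinal i4 = 1 |
   have -> : Ordinal i4 = 2]; by [|apply/val_inj].
Qed.

Lemma ord2_ind (P : 'I_2 -> Prop) : P 0 -> P 1 -> forall i, P i.
Proof.
move=> P0 P1 [[|[|//]] i4];
  [have -> : Ordinal i4 = 0 | have -> : Ordinal i4 = 1]; by [|apply/val_inj].
Qed.

End Index.

(** * Quaternions and their right multiplications *)

Section Quaternions.
Variable R : realType.
Implicit Types (x y z u v w q : 'rV[R]_4) (A K : 'M[R]_4).

Local Notation conj := (@qconj R).
Local Notation q1 := (quat 1 0 0 0 : 'rV[R]_4).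

Lemma quatE (a b c d : R) : (quat a b c d 0 0 = a) * (quat a b c d 0 1 = b) *
  (quat a b c d 0 2 = c) * (quat a b c d 0 3 = d).
Proof. by do !split; rewrite mxE. Qed.

Lemma quatP x y : x 0 0 = y 0 0 -> x 0 1 = y 0 1 -> x 0 2 = y 0 2 ->
  x 0 3 = y 0 3 -> x = y.
Proof. by move=> *; apply/rowP; elim/ord4_ind. Qed.

Lemma dotE x y : dot x y =
  x 0 0 * y 0 0 + x 0 1 * y 0 1 + x 0 2 * y 0 2 + x 0 3 * y 0 3.
Proof. by rewrite /dot mxE big_ord4 !mxE. Qed.

Lemma qmulE x y :
  (qmul x y 0 0 = x 0 0 * y 0 0 - x 0 1 * y 0 1 - x 0 2 * y 0 2 - x 0 3 * y 0 3) *
  (qmul x y 0 1 = x 0 0 * y 0 1 + x 0 1 * y 0 0 + x 0 2 * y 0 3 - x 0 3 * y 0 2) *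
  (qmul x y 0 2 = x 0 0 * y 0 2 - x 0 1 * y 0 3 + x 0 2 * y 0 0 + x 0 3 * y 0 1) *
  (qmul x y 0 3 = x 0 0 * y 0 3 + x 0 1 * y 0 2 - x 0 2 * y 0 1 + x 0 3 * y 0 0).
Proof. by rewrite /qmul !quatE. Qed.

Lemma qconjE x : (conj x 0 0 = x 0 0) * (conj x 0 1 = - x 0 1) *
  (conj x 0 2 = - x 0 2) * (conj x 0 3 = - x 0 3).
Proof. by rewrite /qconj !quatE. Qed.

Lemma add_rowE x y i : (x + y) 0 i = x 0 i + y 0 i. Proof. exact: mxE. Qed.
Lemma opp_rowE x i : (- x) 0 i = - x 0 i. Proof. exact: mxE. Qed.
Lemma scale_rowE a x i : (a *: x) 0 i = a * x 0 i. Proof. exact: mxE. Qed.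

Definition coordE := (qmulE, qconjE, quatE, add_rowE, opp_rowE, scale_rowE, dotE).

Lemma qmulA x y z : qmul x (qmul y z) = qmul (qmul x y) z.
Proof. by apply: quatP; rewrite !coordE; ring. Qed.

Lemma qmulDl x y z : qmul (x + y) z = qmul x z + qmul y z.
Proof. by apply: quatP; rewrite !coordE; ring. Qed.

Lemma qmulDr x y z : qmul z (x + y) = qmul z x + qmul z y.
Proof. by apply: quatP; rewrite !coordE; ring. Qed.

Lemma qmulZl a x y : qmul (a *: x) y = a *: qmul x y.
Proof. by apply: quatP; rewrite !coordE; ring. Qed.

Lemma qmulZr a x y : qmul x (a *: y) = a *: qmul x y.
Proof. by apply: quatP; rewrite !coordE; ring. Qed.

Lemma qmulNl x y : qmul (- x) y = - qmul x y.
Proof. by rewrite -scaleN1r qmulZl scaleN1r. Qed.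

Lemma qmulNr x y : qmul x (- y) = - qmul x y.
Proof. by rewrite -scaleN1r qmulZr scaleN1r. Qed.

Lemma qmul1l x : qmul q1 x = x.
Proof. by apply: quatP; rewrite !coordE; ring. Qed.

Lemma qmul1r x : qmul x q1 = x.
Proof. by apply: quatP; rewrite !coordE; ring. Qed.

Lemma qconj_anticomm x y : qmul (conj x) y = (2 * dot x y) *: q1 - qmul (conj y) x.
Proof. by apply: quatP; rewrite !coordE; ring. Qed.

Lemma qmul_conj_anticomm x y :
  qmul x (conj y) = (2 * dot x y) *: q1 - qmul y (conj x).
Proof. by apply: quatP; rewrite !coordE; ring. Qed.

Lemma qconjMl x : qmul (conj x) x = dot x x *: q1.
Proof. by apply: quatP; rewrite !coordE; ring. Qed.

Lemma qmul_conj x : qmul x (conj x) = dot x x *: q1.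
Proof. by apply: quatP; rewrite !coordE; ring. Qed.

(* The matrix of u |-> u q on row vectors. *)
Definition qright q : 'M[R]_4 :=
  let a := q 0 0 in let b := q 0 1 in let c := q 0 2 in let d := q 0 3 in
  \matrix_(i, j) ([:: quat a b c d; quat (- b) a (- d) c;
                      quat (- c) d a (- b); quat (- d) (- c) b a]`_i 0 j).

Lemma mul_qright u q : u *m qright q = qmul u q.
Proof.
apply: quatP; rewrite qmulE /qright mxE big_ord4 !mxE /=; ring.
Qed.

Lemma qrightM x y : qright (qmul x y) = qright x *m qright y.
Proof.
by apply/row_matrixP => i; rewrite rowE mul_qright qmulA rowE mulmxA !mul_qright.
Qed.

Lemma qrightD x y : qright (x + y) = qright x + qright y.
Proof. by apply/row_matrixP => i; rewrite !rowE mulmxDr !mul_qright qmulDr. Qed.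

Lemma qrightZ a x : qright (a *: x) = a *: qright x.
Proof. by apply/row_matrixP => i; rewrite !rowE -scalemxAr !mul_qright qmulZr. Qed.

End Quaternions.

Section Omega.
Variable R : realType.
Implicit Types (x y z u v w q : 'rV[R]_4) (A K : 'M[R]_4).

Lemma omega_stdE (i : 'I_3) : omega_std R i =
  qright (quat 0 (i == 0)%:R (i == 1)%:R (i == 2)%:R).
Proof.
apply/matrixP => k l; rewrite /omega_std /omega /wedge /qright.
by elim/ord3_ind: i; elim/ord4_ind: k; elim/ord4_ind: l;
  rewrite /= !(mxE, big_ord1) /=; ring.
Qed.

Lemma omegaE A (i : 'I_3) : omega A i = A^T *m omega_std R i *m A.
Proof.
have wedgeE k l : wedge (row k A) (row l A) =
    A^T *m wedge (row k 1%:M) (row l 1%:M) *m A.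
  rewrite /wedge mulmxBr mulmxBl !mulmxA.
  have rowA m : row m A = row m 1%:M *m A by rewrite -row_mul mul1mx.
  by rewrite (rowA k) (rowA l) !trmx_mul !mulmxA.
elim/ord3_ind: i; rewrite /omega_std /omega /= mulmxBr mulmxBl -!wedgeE //.
Qed.

End Omega.

(** * Oriented orthonormal frames of R^4 through quaternions *)

Section SO4.
Variable R : realType.
Implicit Types (x y z u v w q : 'rV[R]_4) (A K : 'M[R]_4).

Local Notation q1 := (quat 1 0 0 0 : 'rV[R]_4).

(** With entries given by a function on [nat], deleting a row and a column becomes a reindexing by
    [bump] that computes, so the cofactor expansions reduce to polynomials. *)
Lemma det_matrix_minor n (a : nat -> nat -> R) (k : 'I_n.+1) :
  row' ord0 (col' k (\matrix_(i < n.+1, j < n.+1) a i j)) =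
  \matrix_(i < n, j < n) a i.+1 (bump k j).
Proof. by apply/matrixP => i j; rewrite !mxE. Qed.

Lemma det_matrix3 (a : nat -> nat -> R) :
  \det (\matrix_(i < 3, j < 3) a i j) =
    a 0%N 0%N * (a 1%N 1%N * a 2%N 2%N - a 1%N 2%N * a 2%N 1%N)
    - a 0%N 1%N * (a 1%N 0%N * a 2%N 2%N - a 1%N 2%N * a 2%N 0%N)
    + a 0%N 2%N * (a 1%N 0%N * a 2%N 1%N - a 1%N 1%N * a 2%N 0%N).
Proof.
rewrite (expand_det_row _ ord0) !big_ord_recl big_ord0 /cofactor.
do 2 (rewrite !(expand_det_row _ ord0) !big_ord_recl !big_ord0 /cofactor).
rewrite !det_mx00 !mxE /= /bump /=; ring.
Qed.

Lemma det_minor4 (a : nat -> nat -> R) (k : 'I_4)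
    (b := fun i j => a i.+1 (bump k j)) :
  \det (row' ord0 (col' k (\matrix_(i < 4, j < 4) a i j))) =
    b 0%N 0%N * (b 1%N 1%N * b 2%N 2%N - b 1%N 2%N * b 2%N 1%N)
    - b 0%N 1%N * (b 1%N 0%N * b 2%N 2%N - b 1%N 2%N * b 2%N 0%N)
    + b 0%N 2%N * (b 1%N 0%N * b 2%N 1%N - b 1%N 1%N * b 2%N 0%N).
Proof. by rewrite det_matrix_minor (det_matrix3 b). Qed.

Lemma det_mx44 A : \det A =
  let m i j k l := A 0 i * A 1 j * A 2 k * A 3 l in
  m 0 1 2 3 - m 0 1 3 2 - m 0 2 1 3 + m 0 2 3 1 + m 0 3 1 2 - m 0 3 2 1
  - m 1 0 2 3 + m 1 0 3 2 + m 1 2 0 3 - m 1 2 3 0 - m 1 3 0 2 + m 1 3 2 0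
  + m 2 0 1 3 - m 2 0 3 1 - m 2 1 0 3 + m 2 1 3 0 + m 2 3 0 1 - m 2 3 1 0
  - m 3 0 1 2 + m 3 0 2 1 + m 3 1 0 2 - m 3 1 2 0 - m 3 2 0 1 + m 3 2 1 0.
Proof.
pose a (i j : nat) := A (inord i) (inord j).
have -> : A = \matrix_(i < 4, j < 4) a i j.
  by apply/matrixP => i j; rewrite mxE /a !inord_val.
rewrite (expand_det_row _ ord0) !big_ord_recl big_ord0 /cofactor.
rewrite !det_minor4 !mxE /= /bump /=; ring.
Qed.

(** For pairwise orthogonal x, y, z the product z conj(y) x is their cross product in R^4; the last
    three terms correct this when orthogonality fails. *)
Lemma det_qmul A : let e i := row i A in
  \det A = dot (qmul (qmul (e 2) (qconj (e 1))) (e 0)) (e 3)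
    - dot (e 2) (e 1) * dot (e 0) (e 3) + dot (e 2) (e 0) * dot (e 1) (e 3)
    - dot (e 1) (e 0) * dot (e 2) (e 3).
Proof.
rewrite /= det_mx44 !dotE !(qmulE, qconjE) !mxE /=; ring.
Qed.

End SO4.

Section AdaptedQuaternions.
Variable R : realType.
Implicit Types (x y z u v w q : 'rV[R]_4) (A K : 'M[R]_4).

Local Notation q1 := (quat 1 0 0 0 : 'rV[R]_4).

Lemma dot_row_mul n m p (A : 'M[R]_(n, m)) (B : 'M[R]_(p, m)) i j :
  dot (row i A) (row j B) = (A *m B^T) i j.
Proof. by rewrite /dot tr_row !mxE; apply: eq_bigr => k _; rewrite !mxE. Qed.

Lemma dot_mul_row n m (A : 'M[R]_(n, m)) (u : 'rV[R]_m) i :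
  dot u (row i A) = (u *m A^T) 0 i.
Proof. by rewrite /dot [LHS]mxE [RHS]mxE; apply: eq_bigr => k _; rewrite !mxE. Qed.

Lemma dotC n (u v : 'rV[R]_n) : dot u v = dot v u.
Proof. by rewrite /dot !mxE; apply: eq_bigr => i _; rewrite !mxE mulrC. Qed.

Lemma dot_triple1 x y z :
  dot (qmul (qmul z (qconj y)) x) x = dot x x * dot z y.
Proof.
by rewrite !coordE; ring.
Qed.

Lemma dot_triple2 x y z : dot (qmul (qmul z (qconj y)) x) y =
  2 * dot z y * dot y x - dot y y * dot z x.
Proof.
by rewrite !coordE; ring.
Qed.

Lemma dot_triple3 x y z :
  dot (qmul (qmul z (qconj y)) x) z = dot z z * dot y x.
Proof.
by rewrite !coordE; ring.
Qed.

(** The triple product is orthogonal to the first three rows by the [dot_triple] identities, and its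
    inner product with the last row is the determinant, which is 1. Its coordinates in the
    orthonormal basis of rows are therefore 0, 0, 0, 1. *)
Lemma orthonormal_row3 A (e := fun i => row i A) :
  A *m A^T = 1%:M -> \det A = 1 -> e 3 = qmul (qmul (e 2) (qconj (e 1))) (e 0).
Proof.
move=> AAT detA; have E i j : dot (e i) (e j) = (i == j)%:R.
  by rewrite dot_row_mul AAT mxE.
pose w := qmul (qmul (e 2) (qconj (e 1))) (e 0).
have w0 : dot w (e 0) = 0 by rewrite dot_triple1 !E /= mulr0.
have w1 : dot w (e 1) = 0 by rewrite dot_triple2 !E /= !mulr0 subrr.
have w2 : dot w (e 2) = 0 by rewrite dot_triple3 !E /= mulr0.
have w3 : dot w (e 3) = 1.
  by move: detA; rewrite det_qmul -!/(e _) !E /= !mul0r !subr0 addr0.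
have wA : w *m A^T = row 3 (1%:M : 'M[R]_4).
  have wi i : (w *m A^T) 0 i = dot w (e i).
    by rewrite dot_mul_row.
  by apply: quatP; rewrite wi !mxE ?w0 ?w1 ?w2 ?w3.
rewrite -/w -[w]mulmx1 -(mulmx1C AAT) mulmxA wA.
by rewrite -row_mul mul1mx.
Qed.

(** Moving a conjugate across two orthogonal vectors changes the sign, and e_3 (counting from 0) is
    the triple product of the other rows. These rules determine the right action of [n1] and [n2] on
    all four frame vectors. *)
Lemma omega_qright A (e := fun i => row i A)
    (n1 := qmul (qconj (e 0)) (e 1)) (n2 := qmul (qconj (e 0)) (e 2)) :
  A *m A^T = 1%:M -> \det A = 1 ->
  [/\ omega A 0 = qright n1, omega A 1 = qright n2 &
      omega A 2 = qright (qmul n1 n2)].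
Proof.
move=> AAT detA; have E i j : dot (e i) (e j) = (i == j)%:R.
  by rewrite dot_row_mul AAT mxE.
have ATA := mulmx1C AAT.
have e3 := orthonormal_row3 AAT detA; rewrite -!/(e _) in e3.
have en i : qmul (qconj (e i)) (e i) = q1 by rewrite qconjMl E eqxx scale1r.
have ne i : qmul (e i) (qconj (e i)) = q1 by rewrite qmul_conj E eqxx scale1r.
have ac i j : i != j -> qmul (qconj (e i)) (e j) = - qmul (qconj (e j)) (e i).
  by move=> ij; rewrite qconj_anticomm E (negbTE ij) mulr0 scale0r sub0r.
have ca i j : i != j -> qmul (e i) (qconj (e j)) = - qmul (e j) (qconj (e i)).
  by move=> ij; rewrite qmul_conj_anticomm E (negbTE ij) mulr0 scale0r sub0r.
(* Since [A] is orthogonal, a form is identified by its action on the four frame vectors, that is,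
   row by row in [omega_std R i *m A]. *)
have std i n : omega_std R i *m A = A *m qright n -> omega A i = qright n.
  by move=> H; rewrite omegaE -mulmxA H mulmxA ATA mul1mx.
have row_std i k : row k (omega_std R i *m A) = \sum_j omega_std R i k j *: e j.
  by rewrite row_mul mulmx_sum_row; apply: eq_bigr => j _; rewrite mxE.
have O1 : omega A 0 = qright n1.
  apply/std/row_matrixP; elim/ord4_ind; rewrite row_std row_mul mul_qright;
    rewrite -/(e _) /n1 qmulA omega_stdE big_ord4 !mxE /=;
    rewrite ?(oppr0, scaleNr, scale0r, scale1r, add0r, addr0).
  - by rewrite ne qmul1l.
  - by rewrite ca// qmulNl -qmulA en qmul1r.
  - by rewrite -qmulA ac// qmulNr qmulA -e3.
  - by rewrite {1}e3 -!qmulA [qmul _ (qmul _ (e 1))]qmulA ne qmul1l en qmul1r.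
have O2 : omega A 1 = qright n2.
  apply/std/row_matrixP; elim/ord4_ind; rewrite row_std row_mul mul_qright;
    rewrite -/(e _) /n2 qmulA omega_stdE big_ord4 !mxE /=;
    rewrite ?(oppr0, scaleNr, scale0r, scale1r, add0r, addr0).
  - by rewrite ne qmul1l.
  - by rewrite ca// qmulNl -qmulA ac// qmulNr opprK qmulA ca// qmulNl -qmulA ac//
       qmulNr opprK qmulA -e3.
  - by rewrite ca// qmulNl -qmulA en qmul1r.
  - rewrite {1}e3 -!qmulA [qmul _ (qmul _ (e 2))]qmulA ne qmul1l ac//.
    by rewrite qmulNr qmulA ne qmul1l.
(* The third form is the matrix product of the first two: this holds for the standard forms because
   ij = k, and conjugation by the orthogonal [A] preserves products. *)
split => //; rewrite qrightM -O1 -O2 !omegaE.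
rewrite -!mulmxA (mulmxA A) AAT mul1mx; congr (_ *m _).
rewrite !mulmxA !omega_stdE -qrightM; congr (qright _ *m _).
by apply: quatP; rewrite !coordE /=; ring.
Qed.

End AdaptedQuaternions.

(** * The octonion associator *)

Section Octonions.
Variable R : realType.
Implicit Types (x y z : 'rV[R]_4 * 'rV[R]_4) (q : 'rV[R]_4).

Lemma qconjD (a b : 'rV[R]_4) : qconj (a + b) = qconj a + qconj b.
Proof. by apply: quatP; rewrite !coordE; ring. Qed.

Lemma qconjZ k (a : 'rV[R]_4) : qconj (k *: a) = k *: qconj a.
Proof. by apply: quatP; rewrite !coordE; ring. Qed.

Lemma qconjN (a : 'rV[R]_4) : qconj (- a) = - qconj a.
Proof. by rewrite -scaleN1r qconjZ scaleN1r. Qed.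

Lemma qconjM (a b : 'rV[R]_4) : qconj (qmul a b) = qmul (qconj b) (qconj a).
Proof. by apply: quatP; rewrite !coordE; ring. Qed.

Lemma qconjK (a : 'rV[R]_4) : qconj (qconj a) = a.
Proof. by apply: quatP; rewrite !coordE ?opprK. Qed.

Lemma omulDl x y z : omul (x + y) z = omul x z + omul y z.
Proof.
case: x y z => [a b] [c d] [e f]; congr (_, _) => /=.
  by rewrite qmulDl qmulDr opprD addrACA.
by rewrite qmulDl qmulDr addrACA.
Qed.

Lemma omulDr x y z : omul z (x + y) = omul z x + omul z y.
Proof.
case: x y z => [a b] [c d] [e f]; congr (_, _) => /=.
  by rewrite qmulDr qconjD qmulDl opprD addrACA.
by rewrite qmulDl qconjD qmulDr addrACA.
Qed.

Lemma omulZl k x y : omul (k *: x) y = k *: omul x y.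
Proof.
case: x y => [a b] [c d]; congr (_, _) => /=.
  by rewrite qmulZl qmulZr scalerBr.
by rewrite qmulZl qmulZr scalerDr.
Qed.

Lemma omulZr k x y : omul y (k *: x) = k *: omul y x.
Proof.
case: x y => [a b] [c d]; congr (_, _) => /=.
  by rewrite qmulZr qconjZ qmulZl scalerBr.
by rewrite qmulZl qconjZ qmulZr scalerDr.
Qed.

Lemma associatorE x y z :
  associator x y z = omul (omul x y) z - omul x (omul y z).
Proof. by rewrite /associator; case: (omul (omul _ _) _); case: (omul _ _). Qed.

Lemma associatorDl x x' y z :
  associator (x + x') y z = associator x y z + associator x' y z.
Proof. by rewrite !associatorE !omulDl opprD addrACA. Qed.

Lemma associatorDm x y y' z :
  associator x (y + y') z = associator x y z + associator x y' z.
Proof. by rewrite !associatorE omulDr !omulDl omulDr opprD addrACA. Qed.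

Lemma associatorDr x y z z' :
  associator x y (z + z') = associator x y z + associator x y z'.
Proof. by rewrite !associatorE !omulDr opprD addrACA. Qed.

Lemma associatorZl k x y z : associator (k *: x) y z = k *: associator x y z.
Proof. by rewrite !associatorE !omulZl scalerBr. Qed.

Lemma associatorZm k x y z : associator x (k *: y) z = k *: associator x y z.
Proof. by rewrite !associatorE omulZr !omulZl omulZr scalerBr. Qed.

Lemma associatorZr k x y z : associator x y (k *: z) = k *: associator x y z.
Proof. by rewrite !associatorE !omulZr scalerBr. Qed.

Lemma qconj_trace (a : 'rV[R]_4) : qconj a = (2 * a 0 0) *: quat 1 0 0 0 - a.
Proof. by apply: quatP; rewrite !coordE; ring. Qed.

(** Conjugates next to their partner collapse to a norm, and the other conjugates of [a] are
    replaced by twice the real part minus [a]. What remains is linear in a few quaternion products,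
    so the sixteen real coordinates need not be expanded. *)
Lemma associator_xxy x y : associator x x y = 0.
Proof.
rewrite associatorE; apply/eqP; rewrite subr_eq0; apply/eqP.
case: x y => [a b] [c d]; congr (_, _) => /=;
  rewrite ?(qconjM, qconjD, qconjN, qconjK) ?(qmulDl, qmulDr, qmulNl, qmulNr);
  rewrite ?qconjM ?qconjK !qmulA ?qmulNl ?opprD -?[qmul (qmul _ (qconj b)) b]qmulA;
  rewrite -?[qmul (qmul _ b) (qconj b)]qmulA ?qconjMl ?qmul_conj;
  rewrite !(qconj_trace a) ?(qmulDl, qmulDr, qmulNl, qmulNr, qmulZl, qmulZr);
  rewrite ?(qmul1l, qmul1r); apply/rowP => i; rewrite !(add_rowE, opp_rowE, scale_rowE); ring.
Qed.

Lemma associator_xyy x y : associator x y y = 0.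
Proof.
rewrite associatorE; apply/eqP; rewrite subr_eq0; apply/eqP.
case: x y => [a b] [c d]; congr (_, _) => /=;
  rewrite ?(qconjM, qconjD, qconjN, qconjK) ?(qmulDl, qmulDr, qmulNl, qmulNr);
  rewrite ?qconjM ?qconjK !qmulA ?qmulNl ?opprD -?[qmul (qmul _ (qconj d)) d]qmulA;
  rewrite -?[qmul (qmul _ d) (qconj d)]qmulA ?qconjMl ?qmul_conj;
  rewrite !(qconj_trace c) ?(qmulDl, qmulDr, qmulNl, qmulNr, qmulZl, qmulZr);
  rewrite ?(qmul1l, qmul1r); apply/rowP => i; rewrite !(add_rowE, opp_rowE, scale_rowE); ring.
Qed.

Lemma associator_swapl x y z : associator x y z = - associator y x z.
Proof.
have := associator_xxy (x + y) z.
rewrite associatorDl !associatorDm !associator_xxy add0r addr0.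
by move=> /eqP; rewrite addr_eq0 => /eqP.
Qed.

Lemma associator_swapr x y z : associator x y z = - associator x z y.
Proof.
have := associator_xyy x (y + z).
rewrite associatorDm !associatorDr !associator_xyy add0r addr0.
by move=> /eqP; rewrite addr_eq0 => /eqP.
Qed.

Lemma qmul0l (a : 'rV[R]_4) : qmul 0 a = 0.
Proof. by rewrite -[0 in LHS](scale0r 0) qmulZl scale0r. Qed.

Lemma qmul0r (a : 'rV[R]_4) : qmul a 0 = 0.
Proof. by rewrite -[0 in LHS](scale0r 0) qmulZr scale0r. Qed.

Lemma qadd_conj (a : 'rV[R]_4) : a + qconj a = (2 * a 0 0) *: quat 1 0 0 0.
Proof. by apply: quatP; rewrite !coordE; ring. Qed.

Lemma omul_quat (n w u : 'rV[R]_4) : omul (n, 0) (w, u) = (qmul n w, qmul u n).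
Proof. by rewrite /omul qmul0r qmul0l subr0 addr0. Qed.

(** A case of Artin's theorem that two octonions generate an associative subalgebra. It is checked
    directly because the first factor lies in the quaternions: norms are central, and so is w plus
    its conjugate. *)
Lemma associator_mul (n w u : 'rV[R]_4) (x := (n, 0)) (y := (w, u)) :
  associator x y (omul x y) = 0.
Proof.
rewrite associatorE; apply/eqP; rewrite subr_eq0; apply/eqP.
rewrite /x /y omul_quat [omul (w, u) _]/omul omul_quat {x y}.
rewrite /omul !qconjM; congr (_, _).
  rewrite qmulDr qmulNr !qmulA; congr (_ - _).
  rewrite -[qmul (qmul _ (qconj u)) u]qmulA -[qmul (qmul _ _) u]qmulA.
  by rewrite qconjMl !(qmulZr, qmulZl, qmul1r) qconjMl qmul_conj.
rewrite -qconjM -[qmul (qmul u n) w]qmulA -!qmulDr qadd_conj.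
by rewrite !(qmulZl, qmulZr) !qmul1r.
Qed.

(** The associator is trilinear and alternating, so on the span of x, y and xy it is a multiple of
    its value at these three elements, which is zero by hypothesis. *)
Lemma associator_span x y (z : 'I_3 -> 'rV[R]_4 * 'rV[R]_4) :
  associator x y (omul x y) = 0 ->
  (forall i, exists a b c, z i = a *: x + b *: y + c *: omul x y) ->
  associator (z 0) (z 1) (z 2) = 0.
Proof.
set p := omul x y => xyp /[dup] /(_ 0)[a [b [c ->]]].
move=> /[dup] /(_ 1)[a' [b' [c' ->]]] /(_ 2)[a'' [b'' [c'' ->]]].
have xyx (u v : 'rV[R]_4 * 'rV[R]_4) : associator u v u = 0 by rewrite associator_swapr associator_xxy oppr0.
have xpy : associator x p y = 0 by rewrite associator_swapr xyp oppr0.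
have yxp : associator y x p = 0 by rewrite associator_swapl xyp oppr0.
have pxy : associator p x y = 0 by rewrite associator_swapl xpy oppr0.
have ypx : associator y p x = 0 by rewrite associator_swapr yxp oppr0.
have pyx : associator p y x = 0 by rewrite associator_swapr pxy oppr0.
rewrite !(associatorDl, associatorDm, associatorDr).
rewrite !(associatorZl, associatorZm, associatorZr).
by rewrite !(xyx, associator_xxy, associator_xyy, xyp, xpy, yxp, pxy, ypx, pyx)
  !(scaler0, addr0).
Qed.

Lemma trmx_qright q : (qright q)^T = qright (qconj q).
Proof.
apply/matrixP; elim/ord4_ind; elim/ord4_ind; rewrite /qright /qconj;
  by do 2 rewrite ?(mxE, quatE) /=; rewrite ?opprK.
Qed.

Lemma mxtrace_qright q : \tr (qright q) = 4 * q 0 0.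
Proof. by rewrite /mxtrace big_ord4 !mxE /=; ring. Qed.

(** The trace of [qright q] is four times the real part of q. The pairing of [qright q] with a
    standard form is thus four times an imaginary coordinate, and the denominator in [omega_dual] is
    also 4. *)
Lemma to_octonion_qright u q :
  to_octonion (u, qright q) = (quat 0 (q 0 1) (q 0 2) (q 0 3), u).
Proof.
congr (_, _); congr quat; rewrite /omega_dual omega_stdE trmx_qright -!qrightM;
  rewrite !mxtrace_qright !coordE /=;
  by field.
Qed.

End Octonions.

(** * Associativity of a tangent space in terms of its connection coefficients *)

Section AssociativeCriterion.
Variable R : realType.
Implicit Types (A K : 'M[R]_4).

Local Notation q1 := (quat 1 0 0 0 : 'rV[R]_4).

(** This is the commutator of omega^1 with K. The self-dual part of K is a left multiplication and
    commutes with omega^1; the omega^2 and omega^3 components of K, which are half of the two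
    coefficients, bracket omega^1 into twice the other form. *)
Lemma omega_std_skew K : K^T = - K ->
  K^T *m omega_std R 0 + omega_std R 0 *m K =
  (K 1 2 - K 0 3) *: omega_std R 1 + (K 0 2 + K 1 3) *: omega_std R 2.
Proof.
move=> skK; have sk i j : K i j = - K j i by move/matrixP: skK => /(_ j i); rewrite !mxE.
have d i : K i i = 0 by have := sk i i; lra.
rewrite !omega_stdE skK mulNmx; apply/matrixP.
by elim/ord4_ind; elim/ord4_ind; rewrite !mxE !big_ord4 !mxE /=
  ?d ?(sk 1 0) ?(sk 2 0) ?(sk 3 0) ?(sk 2 1) ?(sk 3 1) ?(sk 3 2); ring.
Qed.

Lemma mxtrace_omega A i : A *m A^T = 1%:M -> \tr (omega A i) = 0.
Proof.
move=> AAT; rewrite omegaE mxtrace_mulC mulmxA AAT mul1mx omega_stdE.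
by rewrite mxtrace_qright quatE mulr0.
Qed.

(** With X3 the fibre direction and X1, X2 the lifts of e_1, e_2, the two equations say that X2 = X3
    X1. Then the space is spanned by X3, X1 and their product. Conversely, X2 differs from X3 X1 by
    an imaginary quaternion d in the span of n2 and n3; associativity makes d commute with n1, while
    elements of this span anticommute with n1, so d = 0. *)
Lemma associative_span A a1 b1 a2 b2 : A *m A^T = 1%:M -> \det A = 1 ->
  associative_subspace [set q : 'rV[R]_4 * 'M[R]_4 | exists x y s : R, q =
    (x *: row 0 A + y *: row 1 A, s *: omega A 0 +
     ((x * a1 + y * a2) *: omega A 1 + (x * b1 + y * b2) *: omega A 2))] <->
  a2 = - b1 /\ b2 = a1.
Proof.
move=> AAT detA; set T := [set q | _].
pose e i := row i A; have E i j : dot (e i) (e j) = (i == j)%:R.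
  by rewrite dot_row_mul AAT mxE.
pose n1 := qmul (qconj (e 0)) (e 1); pose n2 := qmul (qconj (e 0)) (e 2).
pose n3 := qmul n1 n2.
have [w1E w2E w3E] : [/\ omega A 0 = qright n1, omega A 1 = qright n2 &
  omega A 2 = qright n3] by exact: omega_qright.
have en i : qmul (qconj (e i)) (e i) = q1 by rewrite qconjMl E eqxx scale1r.
have ne i : qmul (e i) (qconj (e i)) = q1 by rewrite qmul_conj E eqxx scale1r.
have ReO i n : omega A i = qright n -> n 0 0 = 0.
  move=> On; have := mxtrace_omega i AAT; rewrite On mxtrace_qright => /eqP.
  by rewrite mulf_eq0 (negbTE (lt0r_neq0 _))//= => /eqP.
have [[re1 re2] re3] := (ReO _ _ w1E, ReO _ _ w2E, ReO _ _ w3E).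
have Jim (n : 'rV[R]_4) : n 0 0 = 0 -> qconj n = - n.
  by move=> n0; apply: quatP; rewrite !coordE ?n0 ?oppr0.
have e0n1 : qmul (e 0) n1 = e 1 by rewrite /n1 qmulA ne qmul1l.
(* A unit imaginary quaternion squares to -1; the length 1 comes from the unit vector e_1 = e_0
   n1. *)
have nn1 : qmul n1 n1 = - q1.
  have := en 1; rewrite -e0n1 qconjM qmulA -[qmul (qmul _ _) (e 0)]qmulA en.
  by rewrite qmul1r Jim// qmulNl => <-; rewrite opprK.
have nn2 : qmul n2 n2 = - q1.
  have := en 2; rewrite -(qmul1l (e 2)) -(ne 0) -qmulA -/n2.
  rewrite qconjM qmulA -[qmul (qmul _ _) (e 0)]qmulA en.
  by rewrite qmul1r Jim// qmulNl => <-; rewrite opprK.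
clearbody n1 n2.
have n13 : qmul n1 n3 = - n2 by rewrite /n3 qmulA nn1 qmulNl qmul1l.
have n21 : qmul n2 n1 = - n3.
  by have := qconjM n1 n2; rewrite -/n3 !Jim// qmulNl qmulNr opprK => <-.
have n31 : qmul n3 n1 = n2 by rewrite /n3 -qmulA n21 qmulNr n13 opprK.
have n12 : qmul n1 n2 = n3 by [].
clearbody n3.
pose X3 := (n1, 0) : 'rV[R]_4 * 'rV[R]_4.
pose X1 : 'rV[R]_4 * 'rV[R]_4 := (a1 *: n2 + b1 *: n3, e 0).
pose X2 : 'rV[R]_4 * 'rV[R]_4 := (a2 *: n2 + b2 *: n3, e 1).
pose X : 'rV[R]_4 * 'M[R]_4 -> 'rV[R]_4 * 'rV[R]_4 := @to_octonion R.
have TX x y s : X (x *: row 0 A + y *: row 1 A, s *: omega A 0 +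
     ((x * a1 + y * a2) *: omega A 1 + (x * b1 + y * b2) *: omega A 2))
    = s *: X3 + x *: X1 + y *: X2.
  rewrite w1E w2E w3E -!qrightZ -!qrightD /X to_octonion_qright.
  congr (_, _); last by rewrite /= scaler0 add0r.
  apply: quatP; rewrite /= quatE !(add_rowE, scale_rowE) ?re1 ?re2 ?re3; ring.
have X31 : omul X3 X1 = (a1 *: n3 - b1 *: n2, e 1).
  by rewrite /X3 /X1 omul_quat e0n1 qmulDr !qmulZr n12 n13 scalerN.
have assoc0 : associator X3 X1 (omul X3 X1) = 0 by exact: associator_mul.
split=> [Tass|[a2E b2E]]; last first.
  have X2E : X2 = omul X3 X1.
    by rewrite X31 /X2 a2E b2E scaleNr addrC.
  move=> _ _ _ [x [y [s ->]]] [x' [y' [s' ->]]] [x'' [y'' [s'' ->]]].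
  rewrite -!/(X _) !TX X2E.
  apply: (associator_span (z := fun i : 'I_3 => [:: s *: X3 + x *: X1 + y *: omul X3 X1;
    s' *: X3 + x' *: X1 + y' *: omul X3 X1;
    s'' *: X3 + x'' *: X1 + y'' *: omul X3 X1]`_i) assoc0).
  by elim/ord3_ind; do 3 eexists.
(* The numbers [p] and [q] measure the failure of the two equations, and [d] is the resulting gap
   between X2 and X3 X1. *)
pose p := a2 + b1; pose q := b2 - a1; pose d := p *: n2 + q *: n3.
have X2E : X2 = omul X3 X1 + (d, 0).
  rewrite X31; congr (_, _); last by rewrite /= addr0.
  by apply/rowP => i; rewrite /= !(add_rowE, opp_rowE, scale_rowE) /p /q; ring.
have TXi x y s : T (x *: row 0 A + y *: row 1 A, s *: omega A 0 +
     ((x * a1 + y * a2) *: omega A 1 + (x * b1 + y * b2) *: omega A 2)).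
  by exists x, y, s.
have := Tass _ _ _ (TXi 0 0 1) (TXi 1 0 0) (TXi 0 1 0).
rewrite -!/(X _) !TX !scale1r !scale0r !addr0 !add0r X2E.
rewrite associatorDr assoc0 add0r => /(congr1 snd).
have d0 : d 0 0 = 0 by rewrite /d !(add_rowE, scale_rowE) re2 re3; ring.
rewrite associatorE /X3 /X1 omul_quat /omul !(qmul0l, qmul0r, add0r, addr0) /=.
rewrite !(Jim d)// !qmulNr qmulNl opprK -!qmulA => /eqP.
rewrite addrC subr_eq0 => /eqP /(congr1 (qmul (qconj (e 0)))).
(* Cancelling e_0 on the left leaves the statement that [d] commutes with [n1]. *)
rewrite !qmulA en !qmul1l /d qmulDl qmulDr !qmulZl !qmulZr n12 n13 n21 n31.
move=> H.
have H1 : p *: n3 = q *: n2.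
  apply/rowP => i; move/rowP: H => /(_ i); rewrite !(add_rowE, opp_rowE, scale_rowE); lra.
have H2 : p *: n2 = - q *: n3.
  have := congr1 (qmul n1) H1; rewrite !qmulZr n12 n13 => H2.
  by rewrite scaleNr -H2 scalerN opprK.
have n2_neq0 : n2 != 0.
  apply/eqP => n20; move: nn2; rewrite n20 qmul0l => /rowP /(_ 0).
  by rewrite opp_rowE quatE mxE => /eqP; rewrite eq_sym oppr_eq0 oner_eq0.
have pq : (p ^+ 2 + q ^+ 2) *: n2 = 0.
  rewrite scalerDl !expr2 -!scalerA H2 -H1 !scalerA -scalerDl.
  by rewrite mulrN [q * p]mulrC addNr scale0r.
move/eqP: pq; rewrite scaler_eq0 (negbTE n2_neq0) orbF.
rewrite paddr_eq0 ?sqr_ge0// !sqrf_eq0 => /andP[/eqP p0 /eqP q0].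
by split; [apply/eqP; rewrite -addr_eq0; exact/eqP|apply/eqP; rewrite -subr_eq0; exact/eqP].
Qed.

End AssociativeCriterion.

(** * Derivatives of matrix-valued maps and of moving frames *)

Section MatrixDerivative.
Variables (R : realType) (V : normedModType R).

Lemma is_derive_mxP m n (F : V -> 'M[R]_(m, n)) x v dF :
  is_derive x v F dF <-> forall i j, is_derive x v (fun y => F y i j) (dF i j).
Proof.
split=> [[Fx <-] i j|H].
  have Fij := (derivable_mxP F x v).1 Fx i j.
  by apply: DeriveDef => //; rewrite derive_mx// mxE.
have Fx : derivable F x v.
  by apply/derivable_mxP => i j; have [] := H i j.
apply: DeriveDef => //; rewrite derive_mx//; apply/matrixP => i j.
by rewrite mxE; have [] := H i j.
Qed.

Lemma is_derive_mulmx m n p (F : V -> 'M[R]_(m, n)) (G : V -> 'M[R]_(n, p))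
    x v dF dG : is_derive x v F dF -> is_derive x v G dG ->
  is_derive x v (fun y => F y *m G y) (dF *m G x + F x *m dG).
Proof.
move=> /is_derive_mxP HF /is_derive_mxP HG; apply/is_derive_mxP => i j.
rewrite (_ : (fun y => _) = \sum_k (fun y => F y i k) * (fun y => G y k j)); last first.
  by apply/funext => y; rewrite mxE fct_sumE.
apply: is_derive_eq; rewrite !mxE -big_split/=; apply: eq_bigr => k _.
by rewrite /GRing.scale/= addrC; congr (_ + _); exact: mulrC.
Qed.

Lemma is_derive_trmx m n (F : V -> 'M[R]_(m, n)) x v dF :
  is_derive x v F dF -> is_derive x v (fun y => (F y)^T) dF^T.
Proof.
move=> /is_derive_mxP HF; apply/is_derive_mxP => i j; rewrite mxE.
by rewrite (_ : (fun y => _) = fun y => F y j i)//; apply/funext => y; rewrite mxE.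
Qed.

Lemma is_derive_scalemx m n (k : V -> R) (F : V -> 'M[R]_(m, n)) x v dk dF :
  is_derive x v k dk -> is_derive x v F dF ->
  is_derive x v (fun y => k y *: F y) (dk *: F x + k x *: dF).
Proof.
move=> Hk /is_derive_mxP HF; apply/is_derive_mxP => i j.
rewrite (_ : (fun y => _) = k * (fun y => F y i j)); last first.
  by apply/funext => y; rewrite mxE.
apply: is_derive_eq; rewrite !mxE addrC; congr (_ + _); exact: mulrC.
Qed.

End MatrixDerivative.

Section LocalGeometry.
Variable R : realType.

(** Differentiating [A *m A^T = 1] makes the connection matrix K skew, and ['D_v A x = K *m A x].
    The derivative of the form is then the conjugate by [A x] of the expression computed in
    [omega_std_skew]. *)
Lemma derivative_omega n (A : 'rV[R]_n -> 'M[R]_4) x v (W : set 'rV[R]_n)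
    (K := 'D_v A x *m (A x)^T) :
  open W -> W x -> (forall y, W y -> A y *m (A y)^T = 1%:M) ->
  differentiable A x ->
  K^T = - K /\ is_derive x v (fun y => omega (A y) 0)
    ((K 1 2 - K 0 3) *: omega (A x) 1 + (K 0 2 + K 1 3) *: omega (A x) 2).
Proof.
move=> oW Wx AAT dA.
have DA : is_derive x v A ('D_v A x) by apply: derivableP; exact: diff_derivable.
have skK : K^T = - K.
  have D0 : is_derive x v (fun y => A y *m (A y)^T) 0.
    apply: (near_eq_is_derive _ (is_derive_cst (1%:M : 'M[R]_4) x v)).
    by apply: open_near_eq oW Wx _ => y Wy; rewrite AAT.
  have [_ E] := is_derive_mulmx DA (is_derive_trmx DA).
  have [_ E0] := D0; move: E; rewrite E0 => /esym/eqP.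
  rewrite addrC addr_eq0 => /eqP KE.
  by rewrite /K trmx_mul trmxK KE.
split => //; rewrite (_ : (fun y => _) =
    fun y => (A y)^T *m omega_std R 0 *m A y); last first.
  by apply/funext => y; rewrite omegaE.
have DAK : 'D_v A x = K *m A x.
  by rewrite /K -mulmxA (mulmx1C (AAT x Wx)) mulmx1.
apply: is_derive_eq (is_derive_mulmx (is_derive_mulmx (is_derive_trmx DA)
  (is_derive_cst (omega_std R 0) x v)) DA) _.
rewrite mulmx0 addr0 !omegaE /cst.
transitivity ((A x)^T *m (K^T *m omega_std R 0 + omega_std R 0 *m K) *m A x).
  clearbody K; rewrite DAK trmx_mul; move: (omega_std R 0) => Om.
  by rewrite mulmxDr mulmxDl !mulmxA.
rewrite (omega_std_skew skK); move: (omega_std R 1) (omega_std R 2) => Om1 Om2.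
by rewrite mulmxDr mulmxDl -!scalemxAr -!scalemxAl.
Qed.

Lemma derive_mx_entry n p q (F : 'rV[R]_n -> 'M[R]_(p, q)) x v i j :
  differentiable F x -> 'D_v F x i j = 'D_v (fun y => F y i j) x.
Proof. by move=> dF; rewrite derive_mx ?mxE//; exact: diff_derivable. Qed.

Lemma derive_mx_sym n p q (W : set 'rV[R]_n) (F : 'rV[R]_n -> 'M[R]_(p, q)) x v w :
  open W -> W x -> smooth_on W F ->
  'D_v (fun z => 'D_w F z) x = 'D_w (fun z => 'D_v F z) x.
Proof.
move=> oW Wx sF; have sFij i j : smooth_on W (fun y => F y i j).
  by move=> k; have /Ck_on_mxP := sF k; exact.
have half a b i j : 'D_a (fun z => 'D_b F z) x i j =
    'D_a (fun z => 'D_b (fun y => F y i j) z) x.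
  rewrite derive_mx_entry; last exact: smooth_on_differentiable (smooth_on_derive b sF) Wx.
  apply: near_eq_derive; apply: open_near_eq oW Wx _ => y Wy.
  by rewrite derive_mx_entry//; exact: smooth_on_differentiable sF Wy.
apply/matrixP => i j; apply: etrans (half v w i j) _.
exact: etrans (derive_sym v w oW Wx (sFij i j)) (esym (half w v i j)).
Qed.

Lemma derive2_sum_delta n p q (W : set 'rV[R]_n) (F : 'rV[R]_n -> 'M[R]_(p, q)) x v w :
  open W -> W x -> smooth_on W F -> 'D_v (fun z => 'D_w F z) x =
  \sum_i \sum_j (v 0 i * w 0 j) *: partial i (partial j F) x.
Proof.
move=> oW Wx sF.
have dD a : differentiable (fun z => 'D_a F z) x.
  exact: smooth_on_differentiable (smooth_on_derive a sF) Wx.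
rewrite derive_sum_delta//; apply: eq_bigr => i _.
transitivity (v 0 i *: 'D_(delta_mx 0 i) (fun z => \sum_j w 0 j *: partial j F z) x).
  congr (_ *: _); apply: near_eq_derive; apply: open_near_eq oW Wx _ => y Wy.
  by rewrite derive_sum_delta//; exact: smooth_on_differentiable sF Wy.
rewrite (_ : (fun z => _) = \sum_j (w 0 j \*: partial j F)); last first.
  by apply/funext => y; rewrite fct_sumE.
rewrite derive_sum => [|j]; last exact/derivableZ/diff_derivable/dD.
rewrite scaler_sumr; apply: eq_bigr => j _.
by rewrite deriveZ ?scalerA//; exact/diff_derivable/dD.
Qed.

End LocalGeometry.

(** * Smoothness and derivative of the parametrizations of E *)

Section Parametrization.
Variable R : realType.

Lemma Ck_on_mulmx n k (U : set 'rV[R]_n) p q r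
    (F : 'rV[R]_n -> 'M[R]_(p, q)) (G : 'rV[R]_n -> 'M[R]_(q, r)) :
  open U -> Ck_on k U F -> Ck_on k U G -> Ck_on k U (fun x => F x *m G x).
Proof.
move=> oU /(Ck_on_mxP _ _ oU) CF /(Ck_on_mxP _ _ oU) CG.
apply/(Ck_on_mxP _ _ oU) => i j.
under eq_fun do rewrite mxE.
by apply: Ck_on_sum => // l; apply: Ck_onM.
Qed.

Lemma Ck_on_trmx n k (U : set 'rV[R]_n) p q (F : 'rV[R]_n -> 'M[R]_(p, q)) :
  open U -> Ck_on k U F -> Ck_on k U (fun x => (F x)^T).
Proof.
move=> oU /(Ck_on_mxP _ _ oU) CF; apply/(Ck_on_mxP _ _ oU) => i j.
by under eq_fun do rewrite mxE.
Qed.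

Lemma Ck_on_scalemx n k (U : set 'rV[R]_n) p q (f : 'rV[R]_n -> R)
    (F : 'rV[R]_n -> 'M[R]_(p, q)) :
  open U -> Ck_on k U f -> Ck_on k U F -> Ck_on k U (fun x => f x *: F x).
Proof.
move=> oU Cf /(Ck_on_mxP _ _ oU) CF; apply/(Ck_on_mxP _ _ oU) => i j.
by under eq_fun do rewrite mxE; exact: Ck_onM.
Qed.

Lemma Ck_on_comp_mx n m k (U : set 'rV[R]_n) (U' : set 'rV[R]_m)
    (phi : 'rV[R]_n -> 'rV[R]_m) p q (G : 'rV[R]_m -> 'M[R]_(p, q)) :
  open U -> open U' -> (forall x, U x -> U' (phi x)) ->
  Ck_on k U phi -> Ck_on k U' G -> Ck_on k U (fun x => G (phi x)).
Proof.
move=> oU oU' UU' Cphi /(Ck_on_mxP _ _ oU') CG; apply/(Ck_on_mxP _ _ oU) => i j.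
exact: (Ck_on_comp oU UU' Cphi (CG i j)).
Qed.

Lemma Ck_on_omega n k (U : set 'rV[R]_n) (A : 'rV[R]_n -> 'M[R]_4) i :
  open U -> Ck_on k U A -> Ck_on k U (fun x => omega (A x) i).
Proof.
move=> oU CA; under eq_fun do rewrite omegaE.
apply: Ck_on_mulmx => //; apply: Ck_on_mulmx => //; last exact: Ck_on_cst.
exact: Ck_on_trmx.
Qed.

Lemma Ck_on_lsubmx k (U : set 'rV[R]_(2 + 1)) :
  Ck_on k U (fun y : 'rV[R]_(2 + 1) => lsubmx y).
Proof. exact: Ck_on_linear (@continuous_lsubmx _ _ _ _). Qed.

Lemma Ck_on_rsubmx k (U : set 'rV[R]_(2 + 1)) : open U ->
  Ck_on k U (fun y : 'rV[R]_(2 + 1) => rsubmx y 0 0).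
Proof.
move=> oU.
have /(Ck_on_mxP _ _ oU) := @Ck_on_linear _ _ _ k U rsubmx (@continuous_rsubmx R 1 2 1).
exact.
Qed.

Lemma open_lsubmx (W : set 'rV[R]_2) :
  open W -> open [set y : 'rV[R]_(2 + 1) | W (lsubmx y)].
Proof.
move=> oW; apply: (@open_comp _ _ (@lsubmx R 1 2 1)) => // y _.
exact: continuous_lsubmx.
Qed.

(** For F the immersion read in a chart, this is convertible to [imm_map] composed with the
    parametrization of E given by the frame A. *)
Definition bundle_param (F : 'rV[R]_2 -> 'rV[R]_4) (A : 'rV[R]_2 -> 'M[R]_4)
    (y : 'rV[R]_(2 + 1)) : 'rV[R]_4 * 'M[R]_4 :=
  (F (lsubmx y), rsubmx y 0 0 *: omega (A (lsubmx y)) 0).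

Lemma smooth_bundle_param W F A : open W -> smooth_on W F -> smooth_on W A ->
  smooth_on [set y | W (lsubmx y)] (bundle_param F A).
Proof.
move=> oW sF sA k; have oU := open_lsubmx oW.
apply: Ck_on_pair => //.
  apply: (Ck_on_comp_mx (U' := W) (phi := @lsubmx R 1 2 1) (G := F)) => //.
  exact: Ck_on_lsubmx.
apply: Ck_on_scalemx => //; first exact: Ck_on_rsubmx.
apply: (Ck_on_comp_mx (U' := W) (phi := @lsubmx R 1 2 1)
  (G := fun x => omega (A x) 0)) => //; first exact: Ck_on_lsubmx.
exact: Ck_on_omega.
Qed.

Lemma derive_comp_lsubmx p q (G : 'rV[R]_2 -> 'M[R]_(p, q)) (y h : 'rV[R]_(2 + 1)) :
  differentiable G (lsubmx y) ->
  is_derive y h (fun z => G (lsubmx z)) ('D_(lsubmx h) G (lsubmx y)).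
Proof.
move=> dG; have dl := @differentiable_lsubmx R 1 2 1 y.
have dGl := differentiable_comp dl dG.
apply: DeriveDef; first exact: diff_derivable dGl.
rewrite (deriveE _ dGl) (diff_comp dl dG) /= [RHS]deriveE//.
by rewrite diff_lin//; exact: continuous_lsubmx.
Qed.

Lemma diff_bundle_param W F A y h : open W -> smooth_on W F -> smooth_on W A ->
  W (lsubmx y) -> 'd (bundle_param F A) y h =
  ('D_(lsubmx h) F (lsubmx y), rsubmx h 0 0 *: omega (A (lsubmx y)) 0 +
     rsubmx y 0 0 *: 'D_(lsubmx h) (fun x => omega (A x) 0) (lsubmx y)).
Proof.
move=> oW sF sA Wy; have oU := open_lsubmx oW.
have dF := smooth_on_differentiable sF Wy.
have sO : smooth_on W (fun x => omega (A x) 0) by move=> k; exact: Ck_on_omega.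
have dO := smooth_on_differentiable sO Wy.
have d1 : differentiable (fun z : 'rV[R]_(2 + 1) => F (lsubmx z)) y.
  exact: (differentiable_comp (@differentiable_lsubmx R 1 2 1 y) dF).
have d2 : differentiable (fun z : 'rV[R]_(2 + 1) =>
    rsubmx z 0 0 *: omega (A (lsubmx z)) 0) y.
  have s2 : smooth_on [set y : 'rV[R]_(2 + 1) | W (lsubmx y)]
     (fun z => rsubmx z 0 0 *: omega (A (lsubmx z)) 0).
    move=> k; apply: Ck_on_scalemx => //; first exact: Ck_on_rsubmx.
    apply: (Ck_on_comp_mx (U' := W) (phi := @lsubmx R 1 2 1)
      (G := fun x => omega (A x) 0)) => //; exact: Ck_on_lsubmx.
  exact: smooth_on_differentiable s2 Wy.
rewrite /bundle_param diff_pair//; congr (_, _).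
  by rewrite -deriveE//; have [_] := derive_comp_lsubmx h dF.
rewrite -deriveE//.
have dr : is_derive y h (fun z : 'rV[R]_(2 + 1) => rsubmx z 0 0) (rsubmx h 0 0).
  have : is_derive y h (rsubmx : _ -> 'M[R]_(1, 1)) (rsubmx h).
    have dR := @differentiable_rsubmx R 1 2 1 y.
    apply: DeriveDef; first exact: diff_derivable dR.
    by rewrite (deriveE _ dR) diff_lin//; exact: continuous_rsubmx.
  by move/is_derive_mxP; apply.
by have [_] := is_derive_scalemx dr (derive_comp_lsubmx h dO).
Qed.

End Parametrization.

(** * Connection coefficients, second fundamental form and mean curvature at one point *)

Section LocalCriterion.
Variables (R : realType) (W : set 'rV[R]_2) (F : 'rV[R]_2 -> 'rV[R]_4).
Variables (A : 'rV[R]_2 -> 'M[R]_4) (x : 'rV[R]_2) (b0 b1 : 'rV[R]_2).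
Hypotheses (oW : open W) (Wx : W x) (sF : smooth_on W F) (sA : smooth_on W A).
Hypothesis AAT : forall y, W y -> A y *m (A y)^T = 1%:M.
Hypothesis detA : forall y, W y -> \det (A y) = 1.
Hypothesis normalA : forall y v (m : 'I_4), W y -> (1 < m)%N ->
  ('D_v F y *m (A y)^T) 0 m = 0.
Hypothesis tangent0 : row 0 (A x) = b0 *m 'J F x.
Hypothesis tangent1 : row 1 (A x) = b1 *m 'J F x.

(* K v is the connection matrix of the frame in the direction v (a coordinate
   vector), S m v w the Hessian paired with the m-th frame vector; b0 and b1 are
   the coordinates of e_1 and e_2. *)
Local Notation J := ('J F x).
Let K (v : 'rV[R]_2) : 'M[R]_4 := 'D_v A x *m (A x)^T.
Let alpha (v : 'rV[R]_2) : R := K v 1 2 - K v 0 3.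
Let beta (v : 'rV[R]_2) : R := K v 0 2 + K v 1 3.
Let S (m : 'I_4) (v w : 'rV[R]_2) : R := ('D_v (fun z => 'D_w F z) x *m (A x)^T) 0 m.

Let dF : differentiable F x. Proof. exact: smooth_on_differentiable sF Wx. Qed.
Let dA : differentiable A x. Proof. exact: smooth_on_differentiable sA Wx. Qed.

(** With b constant, ['D_b F] is tangent on all of W, so its product with the m-th frame vector
    vanishes there. Differentiating this at x, where ['D_b F] is the l-th frame vector, gives the
    identity, with the sign supplied by the skewness of K. *)
Lemma frame_derivative v b l (m : 'I_4) : row l (A x) = b *m J -> (1 < m)%N ->
  K v l m = S m v b.
Proof.
move=> lb m1.
have dDF : differentiable (fun z => 'D_b F z) x.
  exact: smooth_on_differentiable (smooth_on_derive b sF) Wx.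
have D1 := is_derive_mulmx
  (derivableP (diff_derivable dDF : derivable _ x v))
  (is_derive_trmx (derivableP (diff_derivable dA : derivable _ x v))).
have D0 : is_derive x v (fun z => ('D_b F z *m (A z)^T) 0 m) 0.
  apply: (near_eq_is_derive _ (is_derive_cst (0 : R) x v)).
  by apply: open_near_eq oW Wx _ => y Wy; rewrite normalA.
have [_ E1] := (is_derive_mxP _ _ _ _).1 D1 0 m.
have [_ E0] := D0; move: E1; rewrite E0 mxE -/(S m v b).
have [skK _] := derivative_omega v oW Wx AAT dA.
rewrite deriveEjacobian// -lb -row_mul mxE.
have -> : A x *m ('D_v A x)^T = - K v by rewrite -skK trmx_mul trmxK.
by rewrite mxE => /esym/eqP; rewrite subr_eq0 => /eqP.
Qed.

Lemma hess_normal_sym m v w : S m v w = S m w v.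
Proof.
exact: (congr1 (fun D : 'rV[R]_4 => (D *m (A x)^T) 0 m)
  (derive_mx_sym v w oW Wx sF)).
Qed.

Let B := \matrix_(i < 2) (if i == 0 then b0 else b1).

Lemma coord_frame_orthonormal : (B *m J) *m (B *m J)^T = 1%:M.
Proof.
apply/matrixP => i j; rewrite -dot_row_mul !row_mul !rowK.
elim/ord2_ind: i; elim/ord2_ind: j; rewrite /= -?tangent0 -?tangent1;
  by rewrite dot_row_mul AAT// !mxE.
Qed.

(** Orthonormality of the rows of [B *m J] reads B (J J^T B^T) = 1; the factors are square, so they
    may be exchanged. *)
Lemma gram_inv : (J *m J^T) *m (B^T *m B) = 1%:M.
Proof.
rewrite mulmxA; apply: mulmx1C; rewrite !mulmxA.
by have := coord_frame_orthonormal; rewrite trmx_mul !mulmxA.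
Qed.

Lemma frame_coords v : exists p q, v = p *: b0 + q *: b1.
Proof.
exists ((v *m (J *m J^T) *m B^T) 0 0), ((v *m (J *m J^T) *m B^T) 0 1).
rewrite -{1}[v]mulmx1 -gram_inv !mulmxA mulmx_sum_row.
rewrite !big_ord_recl big_ord0 addr0 !rowK /=.
by congr (_ *: _ + _ *: _); congr (_ _ _); apply: val_inj.
Qed.

Lemma connection_linear p q v w l m : K (p *: v + q *: w) l m = p * K v l m + q * K w l m.
Proof.
by rewrite /K !deriveE// linearP linearZ /= mulmxDl -!scalemxAl !mxE.
Qed.

Lemma alpha_linear p q v w :
  alpha (p *: v + q *: w) = p * alpha v + q * alpha w.
Proof.
have := connection_linear p q v w; rewrite /alpha.
move: (K (p *: v + q *: w)) (K v) (K w) => k kv kw kE.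
by rewrite !kE mulrBr mulrBr opprD addrACA.
Qed.

Lemma beta_linear p q v w : beta (p *: v + q *: w) = p * beta v + q * beta w.
Proof.
have := connection_linear p q v w; rewrite /beta.
move: (K (p *: v + q *: w)) (K v) (K w) => k kv kw kE.
by rewrite !kE mulrDr mulrDr addrACA.
Qed.

Lemma tangent_bundle_param (t : R) :
  range ('d (bundle_param F A) (row_mx x t%:M)) =
  [set q : 'rV[R]_4 * 'M[R]_4 | exists p q' s : R, q =
    (p *: row 0 (A x) + q' *: row 1 (A x), s *: omega (A x) 0 +
     ((p * (t * alpha b0) + q' * (t * alpha b1)) *: omega (A x) 1 +
      (p * (t * beta b0) + q' * (t * beta b1)) *: omega (A x) 2))].
Proof.
have param p q' s h : lsubmx h = p *: b0 + q' *: b1 -> rsubmx h 0 0 = s ->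
  'd (bundle_param F A) (row_mx x t%:M) h =
  (p *: row 0 (A x) + q' *: row 1 (A x), s *: omega (A x) 0 +
     ((p * (t * alpha b0) + q' * (t * alpha b1)) *: omega (A x) 1 +
      (p * (t * beta b0) + q' * (t * beta b1)) *: omega (A x) 2)).
  move=> hl hr; pose v := p *: b0 + q' *: b1.
  have [_ [_ DE]] := derivative_omega v oW Wx AAT dA.
  have eF : 'D_v F x = p *: row 0 (A x) + q' *: row 1 (A x).
    by rewrite deriveEjacobian// mulmxDl -!scalemxAl -tangent0 -tangent1.
  have ea : K v 1 2 - K v 0 3 = p * alpha b0 + q' * alpha b1.
    exact: alpha_linear.
  have eb : K v 0 2 + K v 1 3 = p * beta b0 + q' * beta b1.
    exact: beta_linear.
  rewrite -/(K v) ea eb in DE.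
  have Wy : W (lsubmx (row_mx x t%:M : 'rV[R]_(2 + 1))) by rewrite row_mxKl.
  apply: etrans (diff_bundle_param h oW sF sA Wy) _.
  rewrite row_mxKl row_mxKr hl hr -/v eF DE.
  have -> : (t%:M : 'M[R]_1) 0 0 = t by rewrite mxE eqxx.
  move: (alpha b0) (alpha b1) (beta b0) (beta b1) (omega _ 1) (omega _ 2).
  move=> a a' c c' o1 o2.
  by rewrite [t *: _]scalerDr !scalerA !mulrDr !(mulrCA t).
rewrite eqEsubset; split=> [_ [h _ <-]|_ [p [q' [s ->]]]] /=.
  have [p [q' hl]] := frame_coords (lsubmx h).
  by exists p, q', (rsubmx h 0 0); exact: param.
exists (row_mx (p *: b0 + q' *: b1) s%:M) => //.
by apply: param; rewrite ?row_mxKl ?row_mxKr// mxE eqxx.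
Qed.

Lemma associative_bundle_param (t : R) :
  associative_subspace (range ('d (bundle_param F A) (row_mx x t%:M))) <->
  t * alpha b1 = - (t * beta b0) /\ t * beta b1 = t * alpha b0.
Proof.
by rewrite tangent_bundle_param; apply: associative_span; [exact: AAT|exact: detA].
Qed.

Lemma alpha_beta_trace :
  (alpha b1 + beta b0 = S 2 b0 b0 + S 2 b1 b1) /\
  (beta b1 - alpha b0 = S 3 b0 b0 + S 3 b1 b1).
Proof.
have E0 v m := @frame_derivative v b0 0 m tangent0.
have E1 v m := @frame_derivative v b1 1 m tangent1.
(* Here [u] is the mixed value of the second fundamental form on the two frame vectors: it occurs
   twice, and symmetry makes the occurrences cancel. *)
have tr2 (a b c d s t u : R) : a = s -> b = u -> c = t -> d = u ->
  a - b + (c + d) = t + s by move=> -> -> -> ->; ring.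
have tr3 (a b c d s t u : R) : a = u -> b = s -> c = u -> d = t ->
  a + b - (c - d) = t + s by move=> -> -> -> ->; ring.
split.
  exact: (tr2 _ _ _ _ _ _ _ (E1 b1 2 isT)
    (etrans (E0 b1 3 isT) (hess_normal_sym 3 b1 b0)) (E0 b0 2 isT) (E1 b0 3 isT)).
exact: (tr3 _ _ _ _ _ _ _ (etrans (E0 b1 2 isT) (hess_normal_sym 2 b1 b0)) (E1 b1 3 isT)
  (E1 b0 2 isT) (E0 b0 3 isT)).
Qed.

Lemma jacobian_normal (m : 'I_4) i : (1 < m)%N -> (J *m (A x)^T) i m = 0.
Proof.
move=> m1; have := normalA (delta_mx 0 i) Wx m1.
by rewrite deriveEjacobian// -mulmxA -rowE mxE.
Qed.

Lemma normal_part_frame (w : 'rV[R]_4) (m : 'I_4) : (1 < m)%N ->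
  (normal_part J w *m (A x)^T) 0 m = (w *m (A x)^T) 0 m.
Proof.
move=> m1; rewrite /normal_part mulmxBl.
have zero (u : 'rV[R]_2) : (u *m J *m (A x)^T) 0 m = 0.
  by rewrite -mulmxA mxE big1// => k _; rewrite jacobian_normal// mulr0.
have subE (M N : 'rV[R]_4) : (M - N) 0 m = M 0 m - N 0 m by rewrite !mxE.
by apply: etrans (subE _ _) _; rewrite zero subr0.
Qed.

Let H := \sum_i \sum_j invmx (J *m J^T) i j *: second_fundamental_form F x i j.

Lemma invmx_gram : invmx (J *m J^T) = B^T *m B.
Proof.
have [uG _] := mulmx1_unit gram_inv.
by rewrite -[LHS]mulmx1 -gram_inv mulKmx.
Qed.

(** The inverse Gram matrix is [B^T *m B], whose (i, j) entry sums the products of the i-th and j-th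
    coordinates of b0 and of b1. The trace in coordinates thus becomes the trace over the
    orthonormal pair e_1, e_2. *)
Lemma mean_curvature_frame (m : 'I_4) : (1 < m)%N ->
  (H *m (A x)^T) 0 m = S m b0 b0 + S m b1 b1.
Proof.
move=> m1; pose N i j := (partial i (partial j F) x *m (A x)^T) 0 m.
have SE v w : S m v w = \sum_i \sum_j (v 0 i * w 0 j) * N i j.
  apply: etrans (congr1 (fun D : 'rV[R]_4 => (D *m (A x)^T) 0 m)
    (derive2_sum_delta v w oW Wx sF)) _.
  rewrite mulmx_suml summxE; apply: eq_bigr => i _.
  rewrite mulmx_suml summxE; apply: eq_bigr => j _.
  by rewrite -scalemxAl mxE.
rewrite !SE /H mulmx_suml summxE -big_split; apply: eq_bigr => i _.
rewrite mulmx_suml summxE -big_split; apply: eq_bigr => j _.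
rewrite -scalemxAl [LHS]mxE normal_part_frame// -/(N i j).
apply: etrans (mulrDl _ _ _); congr (_ * _).
rewrite invmx_gram mxE !big_ord_recl big_ord0 addr0.
by congr (_ * _ + _ * _); rewrite ?[B^T _ _]mxE [B _ _]mxE.
Qed.

Lemma mean_curvature_normal : H *m J^T = 0.
Proof.
have [uG _] := mulmx1_unit gram_inv.
rewrite /H mulmx_suml big1// => i _; rewrite mulmx_suml big1// => j _.
rewrite -scalemxAl /second_fundamental_form /normal_part.
by rewrite mulmxBl -[_ *m J *m J^T]mulmxA mulmxKV// subrr scaler0.
Qed.

(** H vanishes exactly when its four coordinates in the frame do. The tangential two are zero by
    [mean_curvature_normal], and the normal two are the traces of [alpha_beta_trace]. *)
Lemma mean_curvature_eq0 : H = 0 <-> alpha b1 = - beta b0 /\ beta b1 = alpha b0.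
Proof.
have [tr2 tr3] := alpha_beta_trace.
have H2 : (H *m (A x)^T) 0 2 = alpha b1 + beta b0.
  by rewrite tr2; exact: mean_curvature_frame.
have H3 : (H *m (A x)^T) 0 3 = beta b1 - alpha b0.
  by rewrite tr3; exact: mean_curvature_frame.
split=> [H0|[ab ba]].
  have zero i : (H *m (A x)^T) 0 i = 0 by rewrite H0 mul0mx mxE.
  split; apply/eqP; first by rewrite -addr_eq0 -H2 zero.
  by rewrite -subr_eq0 -H3 zero.
have tangent b l : row l (A x) = b *m J -> (H *m (A x)^T) 0 l = 0.
  move=> lb; rewrite -dot_mul_row lb /dot trmx_mul mulmxA mean_curvature_normal.
  by rewrite mul0mx mxE.
suff HA : H *m (A x)^T = 0.
  by rewrite -[H]mulmx1 -(mulmx1C (AAT Wx)) mulmxA HA mul0mx.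
apply: quatP; rewrite [RHS]mxE.
- exact: tangent tangent0.
- exact: tangent tangent1.
- by apply: etrans H2 _; rewrite ab addNr.
- by apply: etrans H3 _; rewrite ba subrr.
Qed.

End LocalCriterion.

(** * Existence of smooth adapted frames, and dependence of omega^1 on the frame *)

Section Frames.
Variable R : realType.

Lemma Ck_onN n k (U : set 'rV[R]_n) (f : 'rV[R]_n -> R) :
  open U -> Ck_on k U f -> Ck_on k U (fun x => - f x).
Proof.
move=> oU Cf; under eq_fun do rewrite -mulN1r.
by apply: Ck_onM => //; exact: Ck_on_cst.
Qed.

Lemma Ck_on_dot n m k (U : set 'rV[R]_n) (f g : 'rV[R]_n -> 'rV[R]_m) :
  open U -> Ck_on k U f -> Ck_on k U g -> Ck_on k U (fun x => dot (f x) (g x)).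
Proof.
move=> oU Cf Cg.
have /(Ck_on_mxP _ _ oU) := Ck_on_mulmx oU Cf (Ck_on_trmx oU Cg).
exact.
Qed.

Lemma Ck_on_qconj n k (U : set 'rV[R]_n) (f : 'rV[R]_n -> 'rV[R]_4) :
  open U -> Ck_on k U f -> Ck_on k U (fun x => qconj (f x)).
Proof.
move=> oU /(Ck_on_mxP _ _ oU) Cf; apply/(Ck_on_mxP _ _ oU) => i; rewrite ord1.
elim/ord4_ind; under eq_fun do rewrite qconjE;
  by [exact: Cf | apply: Ck_onN => //; exact: Cf].
Qed.

Lemma Ck_on_qmul n k (U : set 'rV[R]_n) (f g : 'rV[R]_n -> 'rV[R]_4) :
  open U -> Ck_on k U f -> Ck_on k U g -> Ck_on k U (fun x => qmul (f x) (g x)).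
Proof.
move=> oU /(Ck_on_mxP _ _ oU) Cf /(Ck_on_mxP _ _ oU) Cg.
apply/(Ck_on_mxP _ _ oU) => i; rewrite ord1.
have P a b : Ck_on k U (fun x => f x 0 a * g x 0 b) by exact: Ck_onM.
have DP h a b : Ck_on k U h -> Ck_on k U (fun x => h x + f x 0 a * g x 0 b).
  by move=> Ch; exact: Ck_onD.
have DN h a b : Ck_on k U h -> Ck_on k U (fun x => h x - f x 0 a * g x 0 b).
  by move=> Ch; apply: Ck_onD => //; exact: Ck_onN.
elim/ord4_ind; under eq_fun do rewrite qmulE.
- exact: DN _ _ _ (DN _ _ _ (DN _ _ _ (P 0 0))).
- exact: DN _ _ _ (DP _ _ _ (DP _ _ _ (P 0 1))).
- exact: DP _ _ _ (DP _ _ _ (DN _ _ _ (P 0 2))).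
- exact: DP _ _ _ (DN _ _ _ (DP _ _ _ (P 0 3))).
Qed.

Lemma Ck_on_submx n k (U : set 'rV[R]_n) p q (F G : 'rV[R]_n -> 'M[R]_(p, q)) :
  open U -> Ck_on k U F -> Ck_on k U G -> Ck_on k U (fun x => F x - G x).
Proof.
move=> oU CF CG; apply: Ck_onD => //.
under eq_fun do rewrite -scaleN1r; apply: Ck_on_scalemx => //; exact: Ck_on_cst.
Qed.

Definition normalize m (u : 'rV[R]_m) : 'rV[R]_m := (Num.sqrt (dot u u))^-1 *: u.

Lemma dotDl m (u v w : 'rV[R]_m) : dot (u + v) w = dot u w + dot v w.
Proof. by rewrite /dot mulmxDl mxE. Qed.

Lemma dotZl m a (u w : 'rV[R]_m) : dot (a *: u) w = a * dot u w.
Proof. by rewrite /dot -scalemxAl mxE. Qed.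

Lemma dotBl m (u v w : 'rV[R]_m) : dot (u - v) w = dot u w - dot v w.
Proof. by rewrite dotDl -scaleN1r dotZl mulN1r. Qed.

Lemma dot_ge0 m (u : 'rV[R]_m) : 0 <= dot u u.
Proof. by rewrite /dot mxE sumr_ge0// => i _; rewrite mxE -expr2 sqr_ge0. Qed.

Lemma dot_eq0 m (u : 'rV[R]_m) : (dot u u == 0) = (u == 0).
Proof.
apply/idP/eqP => [|->]; last by rewrite /dot mul0mx mxE.
rewrite /dot mxE psumr_eq0; last by move=> j _; rewrite mxE -expr2 sqr_ge0.
move=> /allP u0.
apply/rowP => i; rewrite [RHS]mxE; have := u0 i (mem_index_enum i).
by rewrite mxE mulf_eq0 orbb => /eqP.
Qed.

Lemma dot_gt0 m (u : 'rV[R]_m) : u != 0 -> 0 < dot u u.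
Proof. by move=> u0; rewrite lt_neqAle dot_ge0 eq_sym dot_eq0 u0. Qed.

Lemma normalize_unit m (u : 'rV[R]_m) : u != 0 -> dot (normalize u) (normalize u) = 1.
Proof.
move=> u0; rewrite /normalize dotZl dotC dotZl mulrA.
have s0 : Num.sqrt (dot u u) != 0 by rewrite gt_eqF// sqrtr_gt0 dot_gt0.
by rewrite -{3}(sqr_sqrtr (dot_ge0 u)) -invfM -expr2 mulVf// sqrf_eq0.
Qed.

Lemma smooth_normalize n m (U : set 'rV[R]_n) (g : 'rV[R]_n -> 'rV[R]_m) x :
  open U -> U x -> smooth_on U g -> g x != 0 ->
  exists W, [/\ open W, W x, W `<=` U, (forall y, W y -> g y != 0) &
    smooth_on W (fun y => normalize (g y))].
Proof.
move=> oU Ux sg gx0; pose W := [set y | U y /\ g y != 0].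
have oW : open W.
  rewrite openE => y [Uy gy0]; apply: filterI; first exact: open_nbhs_nbhs.
  have cd : {for y, continuous (fun z => dot (g z) (g z))}.
    exact: (Ck_on_dot oU (sg 0%N) (sg 0%N) y Uy).
  have H := cvgr_gt _ cd 0 (dot_gt0 gy0).
  by near=> z; rewrite /= -dot_eq0 gt_eqF//; near: z; exact: H.
exists W; split => // [y []//|y []//|k].
have sW : smooth_on W g by apply: smooth_on_sub sg => y [].
apply: Ck_on_scalemx => //; apply: Ck_on_invsqrt => //.
  by move=> y [_ gy0]; exact: dot_gt0.
exact: Ck_on_dot.
Unshelve. all: by end_near. Qed.

Lemma dot_normalizel m (u w : 'rV[R]_m) :
  dot u w = 0 -> dot (normalize u) w = 0.
Proof. by move=> uw; rewrite /normalize dotZl uw mulr0. Qed.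

Lemma dot_qmul (u v : 'rV[R]_4) : dot (qmul u v) (qmul u v) = dot u u * dot v v.
Proof. by rewrite !coordE; ring. Qed.

Lemma dot_qconj (u : 'rV[R]_4) : dot (qconj u) (qconj u) = dot u u.
Proof. by rewrite !coordE; ring. Qed.

Definition frame_mx (e : seq 'rV[R]_4) : 'M[R]_4 := \matrix_(i < 4) e`_i.

(* The fourth vector is the cross product of the first three, which avoids a
   choice of sign for the orientation. *)
Definition complete_frame (u v w : 'rV[R]_4) : 'M[R]_4 :=
  frame_mx [:: u; v; w; qmul (qmul w (qconj v)) u].

Lemma complete_frameP u v w (A := complete_frame u v w) :
  dot u u = 1 -> dot v v = 1 -> dot w w = 1 ->
  dot v u = 0 -> dot w u = 0 -> dot w v = 0 -> A *m A^T = 1%:M /\ \det A = 1.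
Proof.
move=> uu vv ww vu wu wv; pose z := qmul (qmul w (qconj v)) u.
have rA : (row 0 A = u) * (row 1 A = v) * (row 2 A = w) * (row 3 A = z).
  by do !split; rewrite rowK.
have zz : dot z z = 1 by rewrite !dot_qmul dot_qconj uu vv ww !mulr1.
have zu : dot z u = 0 by rewrite dot_triple1 wv mulr0.
have zv : dot z v = 0 by rewrite dot_triple2 wv wu !(mulr0, mul0r) subrr.
have zw : dot z w = 0 by rewrite dot_triple3 vu mulr0.
split; last by rewrite det_qmul !rA -/z wv wu vu zz !mul0r !subr0 addr0.
apply/matrixP; elim/ord4_ind; elim/ord4_ind; rewrite -dot_row_mul !rA mxE /= ?mulr1n;
  by rewrite ?(dotC u v) ?(dotC u w) ?(dotC u z) ?(dotC v w) ?(dotC v z) ?(dotC w z)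
     ?(uu, vv, ww, zz, vu, wu, wv, zu, zv, zw).
Qed.

Lemma smooth_complete_frame n (U : set 'rV[R]_n) (u v w : 'rV[R]_n -> 'rV[R]_4) :
  open U -> smooth_on U u -> smooth_on U v -> smooth_on U w ->
  smooth_on U (fun y => complete_frame (u y) (v y) (w y)).
Proof.
move=> oU su sv sw k; apply/(Ck_on_mxP _ _ oU).
have E (f : 'rV[R]_n -> 'rV[R]_4) : Ck_on k U f -> forall j, Ck_on k U (fun y => f y 0 j).
  by move=> /(Ck_on_mxP _ _ oU).
elim/ord4_ind => j; under eq_fun do rewrite mxE /=; apply: E; [exact: su|exact: sv|exact: sw|].
apply: Ck_on_qmul (su k) => //; apply: Ck_on_qmul (sw k) _ => //.
exact: Ck_on_qconj.
Qed.

End Frames.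

Section AdaptedFrames.
Variable R : realType.

Lemma normalizeK m (u : 'rV[R]_m) : u != 0 -> Num.sqrt (dot u u) *: normalize u = u.
Proof.
move=> u0; rewrite /normalize scalerA divff ?scale1r//.
by rewrite gt_eqF// sqrtr_gt0 dot_gt0.
Qed.

Lemma dot_sub_projl m (u v w : 'rV[R]_m) a : dot (u - a *: v) w = dot u w - a * dot v w.
Proof. by rewrite dotBl dotZl. Qed.

Lemma dotZr m (b v : 'rV[R]_m) p : dot b (p *: v) = p * dot b v.
Proof. by rewrite dotC dotZl dotC. Qed.

Lemma dot_lincombr m (b v w : 'rV[R]_m) p q :
  dot b (p *: v + q *: w) = p * dot b v + q * dot b w.
Proof. by rewrite dotC dotDl !dotZl !(dotC b). Qed.

Lemma exists_notin_rows m n (J : 'M[R]_(m, n)) : (m < n)%N ->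
  exists w : 'rV[R]_n, ~~ (w <= J)%MS.
Proof.
move=> mn; have /row_subPn[i iJ] : ~~ (1%:M <= J)%MS; last by exists (row i 1%:M).
apply/negP => /mxrankS; rewrite mxrank1 => nJ.
by have := leq_trans mn (leq_trans nJ (rank_leq_row J)); rewrite ltnn.
Qed.

(** Gram-Schmidt on the two partial derivatives and one constant transverse vector. Each
    normalization shrinks the neighbourhood to where its argument is nonzero; the fourth vector is a
    cross product and needs no further shrinking. *)
Lemma exists_adapted_frame (U : set 'rV[R]_2) (F : 'rV[R]_2 -> 'rV[R]_4) x :
  open U -> U x -> smooth_on U F -> row_free ('J F x) ->
  exists W A, [/\ open W, W x, W `<=` U, smooth_on W A & forall y, W y ->
    [/\ A y *m (A y)^T = 1%:M, \det (A y) = 1, (row 0 (A y) <= 'J F y)%MS,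
        (row 1 (A y) <= 'J F y)%MS & forall v, (v <= 'J F y)%MS ->
        dot (row 2 (A y)) v = 0 /\ dot (row 3 (A y)) v = 0]].
Proof.
move=> oU Ux sF fJ.
pose u1 (y : 'rV[R]_2) : 'rV[R]_4 := 'D_(delta_mx 0 0) F y; pose u2 (y : 'rV[R]_2) : 'rV[R]_4 := 'D_(delta_mx 0 1) F y.
have su1 : smooth_on U u1 by exact: smooth_on_derive.
have su2 : smooth_on U u2 by exact: smooth_on_derive.
have uJ y : U y -> u1 y = row 0 ('J F y) /\ u2 y = row 1 ('J F y).
  move=> Uy; have dF := smooth_on_differentiable sF Uy.
  by split; rewrite /u1 /u2 deriveEjacobian// -rowE.
have [u1x u2x] := uJ x Ux.
have comb (y v : 'rV[R]_2) : v *m 'J F y = v 0 0 *: row 0 ('J F y) + v 0 1 *: row 1 ('J F y).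
  rewrite mulmx_sum_row !big_ord_recl big_ord0 addr0.
  have -> : lift ord0 ord0 = 1 :> 'I_2 by apply/val_inj.
  by have -> : ord0 = 0 :> 'I_2 by apply/val_inj.
have free (v : 'rV[R]_2) : v *m 'J F x = 0 -> v = 0.
  by move=> vJ; apply: (row_free_inj fJ); rewrite vJ mul0mx.
have u1x0 : u1 x != 0.
  apply/eqP => u10; have := free (delta_mx 0 0).
  rewrite -rowE -u1x u10 => /(_ erefl) /rowP /(_ 0).
  by rewrite !mxE => /eqP; rewrite oner_eq0.
have [W1 [oW1 W1x W1U u1W1 sW1]] := smooth_normalize oU Ux su1 u1x0.
pose e1 (y : 'rV[R]_2) : 'rV[R]_4 := normalize (u1 y).
pose g2 (y : 'rV[R]_2) : 'rV[R]_4 := u2 y - dot (u2 y) (e1 y) *: e1 y.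
have s_sub (V : set 'rV[R]_2) (f g h : 'rV[R]_2 -> 'rV[R]_4) : open V ->
    smooth_on V f -> smooth_on V g -> smooth_on V h ->
    smooth_on V (fun y => f y - dot (g y) (h y) *: h y).
  move=> oV sf sg sh k; apply: Ck_on_submx => //.
  by apply: Ck_on_scalemx => //; exact: Ck_on_dot.
have su2' := smooth_on_sub W1U su2.
have sg2 : smooth_on W1 g2 := s_sub W1 u2 u2 e1 oW1 su2' su2' sW1.
have g2x0 : g2 x != 0.
  (* If [g2 x] vanished, [u2 x] would be [c] times [u1 x], and the row (-c, 1) would be a nonzero
     element of the kernel of the Jacobian. *)
  apply/eqP => g20; pose c := dot (u2 x) (e1 x) / Num.sqrt (dot (u1 x) (u1 x)).
  pose v : 'rV[R]_2 := \row_j (if j == 0 then - c else 1).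
  have := free v; rewrite comb -u1x -u2x !mxE /= scale1r scaleNr addrC.
  rewrite /c -scalerA -/(normalize (u1 x)) -/(e1 x) -/(g2 x) g20 => /(_ erefl).
  by move=> /rowP /(_ 1); rewrite !mxE => /eqP; rewrite oner_eq0.
have [W2 [oW2 W2x W21 g2W2 sW2]] := smooth_normalize oW1 W1x sg2 g2x0.
pose e2 (y : 'rV[R]_2) : 'rV[R]_4 := normalize (g2 y).
(* A constant vector suffices: being outside the tangent plane at x makes its normal component [g3]
   nonzero at x, hence nearby. *)
have [w wJ] := exists_notin_rows ('J F x) isT.
pose g3 (y : 'rV[R]_2) : 'rV[R]_4 := w - dot w (e1 y) *: e1 y - dot w (e2 y) *: e2 y.
have sW1' : smooth_on W2 e1 := smooth_on_sub W21 sW1.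
have scst : smooth_on W2 (fun=> w) by move=> k; exact: Ck_on_cst.
have sg3 : smooth_on W2 g3 := s_sub W2 (fun y => w - dot w (e1 y) *: e1 y)
  (fun=> w) e2 oW2 (s_sub W2 (fun=> w) (fun=> w) e1 oW2 scst scst sW1') scst sW2.
have eJ y : U y -> (e1 y <= 'J F y)%MS /\ (e2 y <= 'J F y)%MS.
  move=> Uy; have [E1 E2] := uJ y Uy.
  have e1J : (e1 y <= 'J F y)%MS by rewrite scalemx_sub// E1 row_sub.
  split => //; apply: scalemx_sub; apply: addmx_sub; first by rewrite E2 row_sub.
  by rewrite eqmx_opp; exact: scalemx_sub.
have g3x0 : g3 x != 0.
  apply: contra wJ => /eqP; rewrite /g3 -addrA -opprD => /eqP.
  rewrite subr_eq0 => /eqP ->; have [e1J e2J] := eJ x Ux.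
  by apply: addmx_sub; exact: scalemx_sub.
have [W [oW Wx WW2 g3W sW]] := smooth_normalize oW2 W2x sg3 g3x0.
pose e3 (y : 'rV[R]_2) : 'rV[R]_4 := normalize (g3 y).
exists W, (fun y => complete_frame (e1 y) (e2 y) (e3 y)); split => //.
- by move=> y /WW2 /W21 /W1U.
- apply: smooth_complete_frame => //; first exact: smooth_on_sub sW1'.
  exact: smooth_on_sub sW2.
move=> y Wy; have W2y := WW2 _ Wy; have W1y := W21 _ W2y; have Uy := W1U _ W1y.
have [E1 E2] := uJ y Uy; have [e1J e2J] := eJ y Uy.
have e11 : dot (e1 y) (e1 y) = 1 by apply: normalize_unit; exact: u1W1.
have e22 : dot (e2 y) (e2 y) = 1 by apply: normalize_unit; exact: g2W2.
have e33 : dot (e3 y) (e3 y) = 1 by apply: normalize_unit; exact: g3W.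
have e21 : dot (e2 y) (e1 y) = 0.
  by apply: dot_normalizel; rewrite /g2 dot_sub_projl e11 mulr1 subrr.
have e31 : dot (e3 y) (e1 y) = 0.
  by apply: dot_normalizel; rewrite /g3 dot_sub_projl dot_sub_projl e11 e21 mulr1 mulr0 subrr subr0.
have e32 : dot (e3 y) (e2 y) = 0.
  apply: dot_normalizel; rewrite /g3 dot_sub_projl dot_sub_projl (dotC (e1 y)) e21 e22.
  by rewrite mulr1 mulr0 subr0 subrr.
have [AAT detA] := complete_frameP e11 e22 e33 e21 e31 e32.
split => //; rewrite ?rowK// => v /submxP[a ->].
have ze1 b : dot b (e1 y) = 0 -> dot b (u1 y) = 0.
  move=> be1; rewrite -(normalizeK (u1W1 _ W1y)) dotZr.
  by rewrite -/(e1 y) be1 mulr0.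
have ze2 b : dot b (e1 y) = 0 -> dot b (e2 y) = 0 -> dot b (u2 y) = 0.
  move=> be1 be2; have -> : u2 y = Num.sqrt (dot (g2 y) (g2 y)) *: e2 y +
      dot (u2 y) (e1 y) *: e1 y by rewrite (normalizeK (g2W2 _ W2y)) subrK.
  by rewrite dot_lincombr be1 be2 !mulr0 addr0.
have zv b : dot b (e1 y) = 0 -> dot b (e2 y) = 0 -> dot b (a *m 'J F y) = 0.
  move=> be1 be2; rewrite comb -E1 -E2 dot_lincombr.
  by rewrite (ze1 _ be1) (ze2 _ be1 be2) !mulr0 addr0.
split; apply: zv => //.
- by rewrite dot_triple1 e32 mulr0.
- by rewrite dot_triple2 e32 e31 !(mulr0, mul0r) subrr.
Qed.

(** Since omega^1 is right multiplication by conj(e_1) e_2, only the tangential rows matter. Those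
    of A' are obtained from those of A by an orthogonal 2 by 2 matrix, and [s] is its determinant;
    its square is 1 by Lagrange's identity. *)
Lemma omega_sign (A A' : 'M[R]_4) :
  A *m A^T = 1%:M -> \det A = 1 -> A' *m A'^T = 1%:M -> \det A' = 1 ->
  (forall i m : 'I_4, (i < 2)%N -> (1 < m)%N -> dot (row i A') (row m A) = 0) ->
  exists2 s : R, s ^+ 2 = 1 & omega A' 0 = s *: omega A 0.
Proof.
move=> AAT detA AAT' detA' orth.
have E i j : dot (row i A) (row j A) = (i == j)%:R by rewrite dot_row_mul AAT mxE.
have E' i j : dot (row i A') (row j A') = (i == j)%:R by rewrite dot_row_mul AAT' mxE.
have dec (i : 'I_4) : (i < 2)%N -> exists a b, row i A' = a *: row 0 A + b *: row 1 A.
  move=> i2; exists (dot (row i A') (row 0 A)), (dot (row i A') (row 1 A)).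
  rewrite -{1}[row i A']mulmx1 -(mulmx1C AAT) mulmxA mulmx_sum_row big_ord4.
  by rewrite -!dot_mul_row (orth i 2)// (orth i 3)// !scale0r !addr0.
have [a [b r0]] := dec 0 isT; have [c [d r1]] := dec 1 isT.
have [-> _ _] := omega_qright AAT' detA'; have [-> _ _] := omega_qright AAT detA.
have ab : a ^+ 2 + b ^+ 2 = 1.
  have := E' 0 0; rewrite r0 dot_lincombr !(dotDl, dotZl).
  by rewrite !E /= => H; lra.
have cd : c ^+ 2 + d ^+ 2 = 1.
  have := E' 1 1; rewrite r1 dot_lincombr !(dotDl, dotZl).
  by rewrite !E /= => H; lra.
have acbd : a * c + b * d = 0.
  have := E' 0 1; rewrite r0 r1 dot_lincombr !(dotDl, dotZl).
  by rewrite !E /= => H; lra.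
exists (a * d - b * c).
  transitivity ((a ^+ 2 + b ^+ 2) * (c ^+ 2 + d ^+ 2) - (a * c + b * d) ^+ 2).
    by ring.
  by rewrite ab cd acbd; ring.
rewrite -qrightZ r0 r1; congr qright.
rewrite qconjD !qconjZ !qmulDl !qmulDr !qmulZl !qmulZr !qconjMl !E.
rewrite (qconj_anticomm (row 1 A)) E /= mulr0 scale0r sub0r.
rewrite !scalerA; move: (qmul _ _) => n.
apply/rowP => i; rewrite !(add_rowE, opp_rowE, scale_rowE).
have -> : b * d = - (a * c) by apply/eqP; rewrite -addr_eq0 addrC acbd.
by ring.
Qed.

End AdaptedFrames.

(** * Overlaps of charts and tangent spaces *)

Section Charts.
Variables (R : realType) (n m : nat) (M : smooth_manifold R n).
Implicit Types (c : chart R n M) (p : M) (x : 'rV[R]_n).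

Lemma chart_invP c x : is_chart c -> chart_im c x ->
  chart_dom c (chart_inv c x) /\ chart_map c (chart_inv c x) = x.
Proof. by move=> [_ _ _ _ ci] [p cp <-]; rewrite ci. Qed.

Lemma chart_im_map c p : chart_dom c p -> chart_im c (chart_map c p).
Proof. by move=> cp; exists p. Qed.

Lemma chart_mapK c p : atlas M c -> chart_dom c p -> chart_inv c (chart_map c p) = p.
Proof. by move=> /atlas_chart[_ _ _ _]; apply. Qed.

Lemma overlapP c c' x : is_chart c ->
  (chart_map c @` (chart_dom c `&` chart_dom c')) x <->
  chart_im c x /\ chart_dom c' (chart_inv c x).
Proof.
move=> cc; split=> [[p [cp c'p] <-]|[cx c'x]].
  by case: (cc) => _ _ _ _ ci; rewrite ci//; split => //; exact: chart_im_map.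
by have [cix cxK] := chart_invP cc cx; exists (chart_inv c x).
Qed.

Lemma open_overlap c c' : is_chart c -> open (chart_dom c') ->
  open (chart_map c @` (chart_dom c `&` chart_dom c')).
Proof.
move=> cc oc'; case: (cc) => _ oim _ cinv _.
rewrite openE => x /(overlapP _ _ cc)[cx c'x].
rewrite continuous_open_subspace// in cinv.
have cix : {for x, continuous (chart_inv c)} by apply: cinv; rewrite inE.
have H1 : nbhs x (chart_im c) by exact: open_nbhs_nbhs.
have H2 : nbhs x (chart_inv c @^-1` chart_dom c').
  by apply: cix; exact: open_nbhs_nbhs.
apply: filterS (filterI H1 H2) => y [cy c'y].
by apply/(overlapP _ _ cc).
Qed.

Variable f : M -> 'rV[R]_m.
Hypothesis f_smooth : forall c, atlas M c -> smooth_on (chart_im c) (f \o chart_inv c).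

(** On the overlap the first map factors through the second by the transition map, so by the chain
    rule each row of its Jacobian is a combination of rows of the other. *)
Lemma jacobian_chart_sub c c' p : atlas M c -> atlas M c' ->
  chart_dom c p -> chart_dom c' p ->
  ('J (f \o chart_inv c) (chart_map c p) <=
   'J (f \o chart_inv c') (chart_map c' p))%MS.
Proof.
move=> ac ac' cp c'p; pose x := chart_map c p.
pose phi := chart_map c' \o chart_inv c.
have [cc cc'] := (atlas_chart ac, atlas_chart ac').
have [oc' _ _ _ ci'] := cc'.
have oN := open_overlap cc oc'.
have Nx : (chart_map c @` (chart_dom c `&` chart_dom c')) x by exists p.
have dphi : differentiable phi x := smooth_on_differentiable (atlas_smooth ac ac') Nx.
have phix : phi x = chart_map c' p by rewrite /phi /= chart_mapK.
have dF' : differentiable (f \o chart_inv c') (phi x).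
  apply: smooth_on_differentiable (f_smooth ac') _.
  by rewrite phix; exact: chart_im_map.
have dF : differentiable (f \o chart_inv c) x.
  by apply: smooth_on_differentiable (f_smooth ac) _; exact: chart_im_map.
apply/row_subP => i; apply/submxP; exists (row i ('J phi x)).
rewrite rowE -deriveEjacobian// rowE -deriveEjacobian// -phix -deriveEjacobian//.
rewrite [RHS]deriveE// [X in 'd _ _ X]deriveE//.
transitivity ('d ((f \o chart_inv c') \o phi) x (delta_mx 0 i)).
  rewrite -deriveE; last exact: differentiable_comp.
  apply: near_eq_derive; apply: open_near_eq oN Nx _ => y [q [cq c'q] <-].
  by rewrite /phi /= (chart_mapK ac cq) (chart_mapK ac' c'q).
exact: (congr1 (@^~ (delta_mx 0 i)) (diff_comp dphi dF')).
Qed.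

(** The definition of [tangent_space] lets the chart vary; this allows the computation in one fixed
    chart. *)
Lemma tangent_spaceP c p v : atlas M c -> chart_dom c p ->
  tangent_space f p v <-> (v <= 'J (f \o chart_inv c) (chart_map c p))%MS.
Proof.
move=> ac cp; split=> [[c' [ac' c'p vJ]]|vJ]; last by exists c.
exact: submx_trans vJ (jacobian_chart_sub ac' ac c'p cp).
Qed.

End Charts.

(** * The pointwise criterion on the surface, and nonvanishing of omega^1 *)

Section SurfaceBundle.
Variables (R : realType) (M : smooth_manifold R 2) (g : riemannian_metric M).
Variable f : M -> 'rV[R]_4.
Hypothesis f_isom : isometric_immersion g f.

Lemma smooth_chart c : atlas M c -> smooth_on (chart_im c) (f \o chart_inv c).
Proof. by move=> ac; have [] := f_isom ac. Qed.

Lemma exists_local_adapted_frame c x : atlas M c -> chart_im c x ->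
  exists W A, local_adapted_frame f c W A /\ W x.
Proof.
move=> ac cx; have [_ oim _ _ _] := atlas_chart ac.
have [sF /(_ x cx)[fJ _]] := f_isom ac.
have [W [A [oW Wx WU sA HA]]] := exists_adapted_frame oim cx sF fJ.
exists W, A; split => //; split => // y Wy.
have [cy cyK] := chart_invP (atlas_chart ac) (WU y Wy).
have [AAT detA r0 r1 nrm] := HA y Wy.
have T v : tangent_space f (chart_inv c y) v <-> (v <= 'J (f \o chart_inv c) y)%MS.
  by have := tangent_spaceP smooth_chart v ac cy; rewrite cyK.
by split => //; [exact/T|exact/T|move=> v /T /nrm].
Qed.

(** The factor t in the associativity equations explains the asymmetry: vanishing mean curvature
    implies them for every t, and t = 1 is enough to return. *)
Lemma mean_curvature_associative c W A x : local_adapted_frame f c W A -> W x ->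
  (mean_curvature g f c x = 0 -> forall t,
    associative_subspace (range ('d (bundle_param (f \o chart_inv c) A) (row_mx x t%:M)))) /\
  (associative_subspace (range ('d (bundle_param (f \o chart_inv c) A) (row_mx x 1%:M))) ->
    mean_curvature g f c x = 0).
Proof.
move=> [ac oW Wim sA HA] Wx; pose F := f \o chart_inv c.
have sF : smooth_on W F := smooth_on_sub Wim (smooth_chart ac).
have T y v : W y -> tangent_space f (chart_inv c y) v <-> (v <= 'J F y)%MS.
  move=> Wy; have [cy cyK] := chart_invP (atlas_chart ac) (Wim y Wy).
  by have := tangent_spaceP smooth_chart v ac cy; rewrite cyK.
have AAT y : W y -> A y *m (A y)^T = 1%:M by move=> Wy; have [] := HA y Wy.
have detA y : W y -> \det (A y) = 1 by move=> Wy; have [] := HA y Wy.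
have nrm y v (m : 'I_4) : W y -> (1 < m)%N -> ('D_v F y *m (A y)^T) 0 m = 0.
  move=> Wy; have [_ _ _ _ nrmA] := HA y Wy.
  have dF := smooth_on_differentiable sF Wy.
  have [n2 n3] : dot (row 2 (A y)) ('D_v F y) = 0 /\ dot (row 3 (A y)) ('D_v F y) = 0.
    by apply: nrmA; apply/T => //; rewrite deriveEjacobian// submxMl.
  by rewrite -dot_mul_row dotC; elim/ord4_ind: m.
have [_ _ /(T x _ Wx)/submxP[b0 r0] /(T x _ Wx)/submxP[b1 r1] _] := HA x Wx.
have [E0 E1] := (mean_curvature_eq0 oW Wx sF sA AAT nrm r0 r1,
  associative_bundle_param oW Wx sF sA AAT detA r0 r1).
(* Isometry turns the intrinsic Gram matrix into that of the Jacobian, the form used by the local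
   criterion. *)
have GE : mean_curvature g f c x = \sum_i \sum_j invmx ('J F x *m ('J F x)^T) i j *:
    second_fundamental_form F x i j.
  by rewrite /mean_curvature; have [_ /(_ x (Wim x Wx))[_ ->]] := f_isom ac.
rewrite GE; split.
  move=> /E0[e1 e2] t; apply/E1; split; last first.
    by refine (congr1 (fun r : R => t * r) e2).
  by refine (etrans (congr1 (fun r : R => t * r) e1) (mulrN _ _)).
move=> /(E1 1)[e1 e2]; apply/E0; split; last first.
  by refine (etrans (esym (mul1r _)) (etrans e2 (mul1r _))).
by refine (etrans (esym (mul1r _)) (etrans e1 (congr1 (fun r : R => - r) (mul1r _)))).
Qed.

Lemma qright_asd (u n : 'rV[R]_4) : n 0 0 = 0 -> asd_bundle R (u, qright n).
Proof.
move=> n0; exists (fun i => [:: n 0 1; n 0 2; n 0 3]`_i) => /=.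
rewrite !big_ord_recl big_ord0 addr0 !omega_stdE -!qrightZ -!qrightD.
by congr qright; apply: quatP; rewrite !(add_rowE, scale_rowE) !quatE ?n0 /=; ring.
Qed.

Lemma omega_asd (A : 'M[R]_4) (u : 'rV[R]_4) (t : R) :
  A *m A^T = 1%:M -> \det A = 1 -> asd_bundle R (u, t *: omega A 0).
Proof.
move=> AAT detA; have [OE _ _] := omega_qright AAT detA.
have := mxtrace_omega 0 AAT; rewrite OE mxtrace_qright -qrightZ => n0.
apply: qright_asd; rewrite scale_rowE; move: n0; move: (qmul _ _) => n /eqP.
by rewrite mulf_eq0 (negbTE (lt0r_neq0 _))//= => /eqP ->; rewrite mulr0.
Qed.

(** The trace is invariant under the orthogonal [A], which reduces it to the standard form. It shows
    that omega^1 never vanishes, and it fixes the constant by which a multiple of omega^1 is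
    recovered from a trace. *)
Lemma omega_norm (A : 'M[R]_4) : A *m A^T = 1%:M ->
  \tr (omega A 0 *m (omega A 0)^T) = 4.
Proof.
move=> AAT; rewrite omegaE !trmx_mul trmxK -!mulmxA (mulmxA A A^T) AAT mul1mx.
rewrite mxtrace_mulC -!mulmxA AAT mulmx1 omega_stdE trmx_qright -qrightM.
by rewrite mxtrace_qright !coordE /=; ring.
Qed.

Lemma adapted_omega_sign p A A' : adapted_frame f p A -> adapted_frame f p A' ->
  exists2 s : R, s ^+ 2 = 1 & omega A' 0 = s *: omega A 0.
Proof.
move=> [AAT detA _ _ nA] [AAT' detA' t0 t1 _].
have [[n02 n03] [n12 n13]] := (nA _ t0, nA _ t1).
apply: omega_sign => // i m; rewrite dotC.
elim/ord4_ind: i => //; elim/ord4_ind: m => // _ _; assumption.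
Qed.

(** The derivative is triangular: its first component determines the base direction because the
    Jacobian has full rank, and then the second determines the fibre direction because omega^1 is
    nonzero. *)
Lemma diff_bundle_param_inj W (F : 'rV[R]_2 -> 'rV[R]_4) A (y : 'rV[R]_(2 + 1)) :
  open W -> smooth_on W F -> smooth_on W A -> W (lsubmx y) ->
  A (lsubmx y) *m (A (lsubmx y))^T = 1%:M -> row_free ('J F (lsubmx y)) ->
  injective ('d (bundle_param F A) y).
Proof.
move=> oW sF sA Wy AAT fJ z1 z2.
rewrite (diff_bundle_param z1 oW sF sA Wy) (diff_bundle_param z2 oW sF sA Wy).
have dF := smooth_on_differentiable sF Wy.
move=> E; have dE v := deriveEjacobian v dF.
have E1 : lsubmx z1 = lsubmx z2.
  apply: (row_free_inj fJ).
  by refine (etrans (esym (dE _)) (etrans (congr1 fst E) (dE _))).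
have := congr1 snd E; rewrite E1 /= => /addIr /eqP.
rewrite -subr_eq0 -scalerBl scaler_eq0.
have o0 : omega (A (lsubmx y)) 0 != 0.
  apply/eqP => o0; have := omega_norm AAT; rewrite o0 mul0mx mxtrace0 => /esym/eqP.
  by rewrite (negbTE (lt0r_neq0 _)).
rewrite (negbTE o0) orbF subr_eq0 => /eqP r12.
rewrite -(hsubmxK z1) -(hsubmxK z2) E1; congr row_mx.
by apply/rowP => i; rewrite ord1.
Qed.

End SurfaceBundle.

(** * The total space of E as an immersed submanifold *)

Section TotalSpace.
Variables (R : realType) (M : smooth_manifold R 2) (g : riemannian_metric M).
Variable f : M -> 'rV[R]_4.
Hypothesis f_isom : isometric_immersion g f.

Definition frame_param (c : chart R 2 M) (A : 'rV[R]_2 -> 'M[R]_4)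
    (y : 'rV[R]_(2 + 1)) : M * 'M[R]_4 :=
  (chart_inv c (lsubmx y), rsubmx y 0 0 *: omega (A (lsubmx y)) 0).

Lemma total_space_pts q : imm_pts (total_space_E f) q <->
  exists2 P, imm_par (total_space_E f) P & exists2 y, P.1 y & P.2 y = q.
Proof.
split=> [[A HA [t Eq]]|[P [c [W [A [HA ->]]]] [y Wy <-]]]; last first.
  have [_ _ _ _ HAy] := HA.
  by exists (A (@lsubmx R 1 2 1 y)); [exact: HAy | exists (@rsubmx R 1 2 1 y 0 0)].
case: q => p eta /= in HA Eq *.
have [c ac cp] := atlas_cover p.
have [W [B [HB Wx]]] := exists_local_adapted_frame f_isom ac (chart_im_map cp).
have [_ _ _ _ HBy] := HB; have := HBy _ Wx; rewrite chart_mapK// => HBx.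
have [s _ Es] := adapted_omega_sign HBx HA.
exists ([set y : 'rV[R]_(2 + 1) | W (lsubmx y)], frame_param c B).
  by exists c, W, B.
(* The given point is t times the form of an arbitrary adapted frame, which is [s] times the form of
   the local frame [B]; hence the fibre coordinate t s. *)
exists (row_mx (chart_map c p) (t * s)%:M); first by rewrite /= row_mxKl.
by rewrite /= /frame_param row_mxKl row_mxKr chart_mapK// mxE eqxx mulr1n Eq Es scalerA.
Qed.

Lemma total_space_asd q : imm_pts (total_space_E f) q ->
  asd_bundle R (imm_map (total_space_E f) q).
Proof.
move=> [A [AAT detA _ _ _] [t Eq]]; rewrite /= Eq; exact: omega_asd.
Qed.

Lemma smooth_row_mx1 (U : set 'rV[R]_(2 + 1)) (phi : 'rV[R]_(2 + 1) -> 'rV[R]_2)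
    (r : 'rV[R]_(2 + 1) -> R) : open U -> smooth_on U phi -> smooth_on U r ->
  smooth_on U (fun z => row_mx (phi z) (r z)%:M : 'rV[R]_(2 + 1)).
Proof.
move=> oU sphi sr k; apply/(Ck_on_mxP _ _ oU) => i j; rewrite ord1.
have /(Ck_on_mxP _ _ oU) Cphi := sphi k.
under eq_fun do rewrite mxE; case: (fintype.split j) => l; first exact: Cphi.
by under eq_fun do rewrite mxE ord1 eqxx mulr1n; exact: sr.
Qed.

(** The change of parametrization sends (x, t) to (phi x, t s(x)), where phi is the transition map
    of the charts and s(x) the sign relating the two forms. It is defined over the set [V] where
    both frames are available. *)
Lemma total_space_transition P P' (y y' : 'rV[R]_(2 + 1)) :
  imm_par (total_space_E f) P -> imm_par (total_space_E f) P' ->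
  P.1 y -> P'.1 y' -> P.2 y = P'.2 y' ->
  exists U tau, [/\ open U, U y, U `<=` P.1, smooth_on U tau &
    forall z, U z -> P'.1 (tau z) /\ P'.2 (tau z) = P.2 z].
Proof.
move=> [c [W [A [HA ->]]]] [c' [W' [A' [HA' ->]]]] /= Wy Wy' [Ey _].
have [ac oW Wim sA HAx] := HA; have [ac' oW' Wim' sA' HAx'] := HA'.
have [cc cc'] := (atlas_chart ac, atlas_chart ac').
have [oc' _ _ _ _] := cc'.
pose N := chart_map c @` (chart_dom c `&` chart_dom c').
have oN : open N := open_overlap cc oc'.
pose phi := chart_map c' \o chart_inv c.
have sphi : smooth_on N phi := atlas_smooth ac ac'.
pose V := [set x | [/\ W x, N x & W' (phi x)]].
have oV : open V.
  rewrite openE => x [Wx Nx W'x].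
  have cphi : {for x, continuous phi} := sphi 0%N x Nx.
  have H : nbhs x (phi @^-1` W') by apply: cphi; exact: open_nbhs_nbhs.
  have H1 : nbhs x W by exact: open_nbhs_nbhs.
  have H2 : nbhs x N by exact: open_nbhs_nbhs.
  by apply: filterS (filterI H1 (filterI H2 H)) => z [? []].
have phiK x : N x -> chart_inv c' (phi x) = chart_inv c x.
  by move=> /(overlapP _ _ cc)[cx c'x]; rewrite /phi /= chart_mapK.
(* Writing the sign as a normalized trace makes it visibly smooth on [V], so that no argument about
   local constancy is needed; 4 is the squared norm of omega^1. *)
pose s x := \tr (omega (A x) 0 *m (omega (A' (phi x)) 0)^T) / 4.
have sE x : V x -> omega (A x) 0 = s x *: omega (A' (phi x)) 0.
  move=> [Wx Nx W'x]; have HAx1 := HAx x Wx; have := HAx' _ W'x; rewrite phiK// => HAx1'.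
  have [e _ Ee] := adapted_omega_sign HAx1' HAx1.
  rewrite {1}Ee; congr (_ *: _).
  rewrite /s Ee -scalemxAl mxtraceZ omega_norm; first by rewrite mulfK// lt0r_neq0.
  by have [] := HAx1'.
have ss : smooth_on V s.
  have sN : smooth_on V phi by apply: smooth_on_sub sphi => x [].
  have sAV : smooth_on V A by apply: smooth_on_sub sA => x [].
  move=> k; have CA' : Ck_on k V (fun x => A' (phi x)).
    by apply: (Ck_on_comp_mx (U' := W') oV oW' _ (sN k) (sA' k)) => x [].
  have C1 := Ck_on_mulmx oV (Ck_on_omega 0 oV (sAV k))
    (Ck_on_trmx oV (Ck_on_omega 0 oV CA')).
  have /(Ck_on_mxP _ _ oV) C2 := C1.
  rewrite /s /mxtrace; apply: Ck_onM => //; last exact: Ck_on_cst.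
  by apply: Ck_on_sum => // i; exact: C2.
pose U := [set z : 'rV[R]_(2 + 1) | V (lsubmx z)].
have oU : open U := open_lsubmx oV.
pose tau (z : 'rV[R]_(2 + 1)) : 'rV[R]_(2 + 1) :=
  row_mx (phi (lsubmx z)) (rsubmx z 0 0 * s (lsubmx z))%:M.
have [c'y' c'yK] := chart_invP cc' (Wim' _ Wy').
have Ny : N (lsubmx y).
  by apply/(overlapP _ _ cc); split; [exact: Wim | rewrite Ey].
exists U, tau; split => //.
- by split => //; rewrite /phi /= Ey c'yK.
- by move=> z [].
- have sl : smooth_on U (fun z : 'rV[R]_(2 + 1) => lsubmx z).
    by move=> k; exact: Ck_on_lsubmx.
  have sV : smooth_on V phi by apply: smooth_on_sub sphi => x [].
  apply: smooth_row_mx1 => // k.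
    exact: (Ck_on_comp_mx (U' := V) oU oV _ (sl k) (sV k)).
  apply: Ck_onM => //; first exact: Ck_on_rsubmx.
  exact: (Ck_on_comp (U' := V) oU _ (sl k) (ss k)).
move=> z Vz; have [Wz Nz W'z] := Vz; rewrite /frame_param /tau row_mxKl row_mxKr.
split => //; rewrite phiK// mxE eqxx mulr1n; congr (_, _).
by rewrite (sE _ Vz) scalerA.
Qed.

(** The base point determines the coordinates in the chart, and the multiple of the nonzero form
    omega^1 determines t. *)
Lemma frame_param_inj c W A (y1 y2 : 'rV[R]_(2 + 1)) :
  local_adapted_frame f c W A -> W (lsubmx y1) -> W (lsubmx y2) ->
  frame_param c A y1 = frame_param c A y2 -> y1 = y2.
Proof.
move=> HA Wy1 Wy2 [E1 E2]; have [ac oW Wim sA HAx] := HA.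
have E : lsubmx y1 = lsubmx y2.
  have [_ <-] := chart_invP (atlas_chart ac) (Wim _ Wy1).
  by rewrite E1; have [_ ->] := chart_invP (atlas_chart ac) (Wim _ Wy2).
rewrite -(hsubmxK y1) -(hsubmxK y2) E; congr row_mx.
have [AAT _ _ _ _] := HAx _ Wy2.
apply/rowP => i; rewrite ord1; move: E2; rewrite E => /eqP.
rewrite -subr_eq0 -scalerBl scaler_eq0 subr_eq0 => /orP[/eqP//|/eqP o0].
have := omega_norm AAT; rewrite o0 mul0mx mxtrace0 => /esym/eqP.
by rewrite (negbTE (lt0r_neq0 _)).
Qed.

Lemma total_space_immersed : is_immersed_submanifold (total_space_E f) (asd_bundle R).
Proof.
split; [exact: total_space_pts|exact: total_space_asd| |exact: total_space_transition].
move=> _ [c [W [A [HA ->]]]] /=; have [ac oW Wim sA HAx] := HA.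
have sF : smooth_on W (f \o chart_inv c) := smooth_on_sub Wim (smooth_chart f_isom ac).
split; first exact: open_lsubmx.
- move=> y1 y2 /set_mem Wy1 /set_mem Wy2 E; exact: (frame_param_inj HA Wy1 Wy2 E).
- exact: smooth_bundle_param oW sF sA.
- move=> y Wy; have [AAT _ _ _ _] := HAx _ Wy.
  apply: (diff_bundle_param_inj oW sF sA Wy AAT).
  by have [_ /(_ _ (Wim _ Wy))[]] := f_isom ac.
Qed.

End TotalSpace.

Theorem theorem4p3p1 (R : realType) (M : smooth_manifold R 2)
    (g : riemannian_metric M) (f : M -> 'rV[R]_4)
    (f_isom : isometric_immersion g f) :
  associative_submanifold (total_space_E f) <-> minimal g f.
Proof.
split=> [[_ assocE] c x ac cx|fmin].
  have [W [A [HA Wx]]] := exists_local_adapted_frame f_isom ac cx.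
  have [_] := mean_curvature_associative f_isom HA Wx; apply.
  (* The hypothesis is used at the point omega^1 of the fibre over x, with coordinates (x, 1), where
     the factor t drops out. *)
  apply: (assocE ([set y : 'rV[R]_(2 + 1) | W (lsubmx y)], frame_param c A)).
    by exists c, W, A.
  by rewrite /= row_mxKl.
split; first exact: total_space_immersed f_isom.
move=> _ y [c [W [A [HA ->]]]] /= Wy.
have [ac oW Wim sA HAx] := HA.
have [/(_ (fmin _ _ ac (Wim _ Wy)))] := mean_curvature_associative f_isom HA Wy.
move=> /(_ (@rsubmx R 1 2 1 y 0 0)) H _.
have Ey : row_mx (@lsubmx R 1 2 1 y) (@rsubmx R 1 2 1 y 0 0)%:M = y.
  by rewrite -mx11_scalar hsubmxK.
by rewrite Ey in H.
Qed.
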